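(* Let $\beta>0$ and $\kappa>0$, where $\kappa$ may depend on $\beta$, with $\kappa<\frac{1}{\pi\beta}$, and set $\tilde\kappa=\kappa\beta$. Then for $\beta>0$ small enough the following hold. There exists a unique minimizer $\varphi_\beta$ of $F_{\beta,\kappa}$ in $\mathcal J$. Moreover, $0<\varphi_\beta(x)<\frac{\pi}{2}$ for all $x\in(0,1)$, $\varphi_\beta\to 0$ in $\mathcal C^\infty(K)$ as $\beta\to0$ for every compact set $K\subset[0,1)$, and for every $x\in[0,1)$ $$\varphi_\beta(x)<2\arctan\left[\left(\tan\frac{\varphi_\beta(1)}{2}\right)e^{\frac{x-1}{\beta}}\right].$$ (i) If $\tilde\kappa=\kappa\beta$ is independent of $\beta$, then $\varphi_\beta(1)=\arcsin(2\tilde\kappa)+o_\beta(1)$ and $$F_{\beta,\kappa}(\varphi_\beta)=\frac{1-\sqrt{1-4\tilde\kappa^2}}{4\beta}-\frac{\tilde\kappa}{2\beta}\arcsin(2\tilde\kappa)+o_\beta(\beta^n)\quad\text{for all } n\in\mathbb N^*.$$ Besides, if $\psi_\beta(x):=\varphi_\beta(1-\beta x)$ (defined for $x\in[0,1/\beta]$), then $\psi_\beta\to\psi_0$ in $\mathcal C^\infty_{loc}([0,+\infty))$, where $\psi_0(x)=2\arctan\left[\tan\left(\frac{\arcsin(2\tilde\kappa)}{2}\right)e^{-x}\right]$. (ii) If $\kappa\beta=o_\beta(1)$, then $\varphi_\beta(1)=2\kappa\beta(1+o_\beta(1))$ and $F_{\beta,\kappa}(\varphi_\beta)=-\frac{\kappa^2\beta}{2}(1+o_\beta(1))$.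 Moreover, if $\Phi_\beta(x):=\frac{\varphi_\beta(1-\beta x)}{2\kappa\beta}$, then $\Phi_\beta\to e^{-x}$ in $\mathcal C^\infty_{loc}([0,+\infty))$.
   Context: For parameters $\beta>0$ and $\kappa>0$ define, for $\varphi\in H^1((0,1))$, $$F_{\beta,\kappa}(\varphi)=\frac18\int_0^1\left(\varphi'(x)^2+\frac{1}{\beta^2}\sin^2\varphi(x)\right)dx-\frac{\kappa}{2}\int_0^1\varphi'(x)\,dx,$$ and $\mathcal J=\{\varphi\in H^1((0,1)):\varphi(0)=0\}$. The parameter $\kappa$ is allowed to depend on $\beta$; the notations $o_\beta$, $O_\beta$ refer to the limit $\beta\to0$. *)

(* Defs.v *)
From HB Require Import structures.
From mathcomp Require Import all_boot all_order all_algebra.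
From mathcomp Require Import all_classical all_reals all_analysis.
Set Implicit Arguments. Unset Strict Implicit. Unset Printing Implicit Defensive.
Import Order.TTheory GRing.Theory Num.Theory.
Import numFieldNormedType.Exports.
Local Open Scope classical_set_scope.
Local Open Scope ring_scope.

Section Defs.
Variable R : realType.
Notation leb := (@lebesgue_measure R).

(* phi belongs to H^1((0,1)), g being its weak derivative:
   g is in L^2(0,1) (hence in L^1(0,1)) and phi is (the continuous
   representative) phi x = phi 0 + \int_0^x g on [0,1]. *)
Definition H1 (phi g : R -> R) : Prop :=
  measurable_fun (`[0, 1] : set R) g /\
  leb.-integrable (`[0, 1] : set R) (EFin \o g) /\
  leb.-integrable (`[0, 1] : set R) (fun x => (g x ^+ 2)%:E) /\
  (forall x, 0 <= x <= 1 -> phi x = phi 0 + \int[leb]_(t in `[0, x]) g t).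

Definition admissible (phi g : R -> R) : Prop := H1 phi g /\ phi 0 = 0.

Definition F (beta kappa : R) (phi g : R -> R) : R :=
  8^-1 * \int[leb]_(x in `[0, 1]) (g x ^+ 2 + (sin (phi x)) ^+ 2 / beta ^+ 2)
  - kappa / 2 * \int[leb]_(x in `[0, 1]) g x.

Definition is_minimizer (beta kappa : R) (phi g : R -> R) : Prop :=
  admissible phi g /\
  forall psi h, admissible psi h -> F beta kappa phi g <= F beta kappa psi h.

Definition smooth_on (a b : R) (f : R -> R) : Prop :=
  forall (k : nat) x, a < x < b -> derivable (derive1n k f) x 1.

End Defs.

(* Main.v *)
Require Import Defs.
From HB Require Import structures.
From mathcomp Require Import all_boot all_order all_algebra.
From mathcomp Require Import all_classical all_reals all_analysis.
From mathcomp Require Import measurable_realfun.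
From mathcomp Require Import ring lra.
Set Implicit Arguments.
Unset Strict Implicit.
Unset Printing Implicit Defensive.
Import Order.TTheory GRing.Theory Num.Theory.
Import numFieldNormedType.Exports.
Local Open Scope classical_set_scope.
Local Open Scope ring_scope.

(** The energy is calibrated by the first integral of the pendulum equation.  For [c > 0] put
    [speed c t = sqrt (c^2 + sin^2 t)] and let [G] be a primitive of [speed c].  Then
      [h^2 + sin^2 psi / beta^2 =
         (h - speed c psi / beta)^2 + 2 speed c psi * h / beta - c^2 / beta^2],
    so with the chain rule [F beta kappa psi h] is an integrated square plus
    [(G (psi 1) - 2 kappa beta psi 1) / (4 beta) - c^2 / (8 beta^2)].  A solution [phi] of
    [beta phi' = speed c phi], [phi 0 = 0], kills the square, and the remaining function of the
    end value is minimal where [speed c (psi 1) = 2 kappa beta], the jump over a period being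
    nonnegative exactly because [kappa beta <= 1 / pi].  It remains to shoot for [c] such that
    the solution satisfies both conditions, which works for every [beta], and the vanishing
    square gives uniqueness.
    Comparing with the separatrix [c = 0] shows that [phi] and [c] are exponentially small
    away from [x = 1], whence all the asymptotics; derivatives of every order are polynomials
    in [phi', sin phi, cos phi], so they converge as soon as these three functions do. *)

(** * Calculus on the line *)

(** The calibration needs [c > 0]: the speed is then smooth and bounded below by [c], so a
    competitor, whose derivative is known only almost everywhere, can be handled through primitives
    of [speed c] and of its inverse composed with [psi]. At [c = 0] the solution starting from 0
    would stay there. The jump over a period is [G pi - 2 kappa beta pi], and [G pi >= 2] because
    the speed dominates [sin]. Negative end values are removed by passing from [psi] to [- psi],
    which lowers the energy by [kappa |psi 1|]. Uniqueness asks only for weak minimality in the end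
    value: a vanishing square together with [psi 0 = 0] already determines [psi]. When [kappa beta]
    tends to 0 the amplitude [k = 2 kappa beta] vanishes too, so errors must be small relative to
    [k]. This is why the bounds on [phi] and [c] carry a factor [k] beside the exponential, and why
    the estimates of that regime are expressed through [c / k]. *)

Section Calculus.
Context {R : realType}.
Implicit Types (f df u du : R -> R) (a b c x y : R).

Lemma is_derive_continuous f df : (forall x, is_derive x (1 : R) f (df x)) -> continuous f.
Proof.
move=> fd x; apply/differentiable_continuous/derivable1_diffP.
exact: (@ex_derive _ _ _ _ _ _ _ (fd x)).
Qed.

Lemma is_derive_MVT f df a b : a <= b ->
  (forall x, a <= x <= b -> is_derive x (1 : R) f (df x)) ->
  exists2 c, a <= c <= b & f b - f a = df c * (b - a).
Proof.
move=> ab fd.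
have [| |c] := @MVT_segment R f df a b ab.
- move=> x; rewrite in_itv/= => /andP[ax xb]; apply: fd; by rewrite !ltW.
- apply: derivable_within_continuous => x; rewrite in_itv/= => xab.
  exact: (@ex_derive _ _ _ _ _ _ _ (fd x xab)).
by rewrite in_itv/= => cab eqc; exists c.
Qed.

Lemma is_derive_ge0_le f df a b : a <= b ->
  (forall x, a <= x <= b -> is_derive x (1 : R) f (df x)) ->
  (forall x, a <= x <= b -> 0 <= df x) -> f a <= f b.
Proof.
move=> ab fd df0; have [c cab e] := is_derive_MVT ab fd.
by rewrite -subr_ge0 e mulr_ge0 ?df0 // subr_ge0.
Qed.

Lemma is_derive_gt0_lt f df a b : a < b ->
  (forall x, a <= x <= b -> is_derive x (1 : R) f (df x)) ->
  (forall x, a <= x <= b -> 0 < df x) -> f a < f b.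
Proof.
move=> ab fd df0; have [c cab e] := is_derive_MVT (ltW ab) fd.
by rewrite -subr_gt0 e mulr_gt0 ?df0 // subr_gt0.
Qed.

Lemma is_derive_lipschitz f df (k : R) :
  (forall x, is_derive x (1 : R) f (df x)) -> (forall x, `|df x| <= k) ->
  forall x y, `|f x - f y| <= k * `|x - y|.
Proof.
move=> fd dfk x y; wlog xy : x y / y <= x.
  by move=> H; case: (leP y x) => [/H //|/ltW /H]; rewrite distrC [in X in _ <= X]distrC.
have [c _ ->] := is_derive_MVT xy (fun z _ => fd z).
by rewrite normrM ler_wpM2r.
Qed.

(** The uniform lower bound [m] makes [f] onto: the intermediate value theorem applies between
    [- |y| / m] and [|y| / m]. The inverse is thus defined on the whole line, which makes the flow
    obtained from it global. *)
Lemma increasing_derivative_inverse f df (m : R) : 0 < m ->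
  f 0 = 0 -> (forall x, is_derive x (1 : R) f (df x)) -> (forall x, m <= df x) ->
  exists g : R -> R, [/\ cancel g f, cancel f g & forall x, is_derive x (1 : R) g (df (g x))^-1].
Proof.
move=> m0 f0 fd dfm.
have fcont := is_derive_continuous fd.
have finj : injective f.
  move=> x y fxy; apply/eqP; rewrite eq_le; apply/andP; split; rewrite leNgt; apply/negP => h;
  by (have := @is_derive_gt0_lt f df _ _ h (fun z _ => fd z)
        (fun z _ => lt_le_trans m0 (dfm z)); rewrite fxy ltxx).
have grow a b : a <= b -> m * (b - a) <= f b - f a.
  move=> ab; have [c _ ->] := is_derive_MVT ab (fun z _ => fd z).
  by rewrite ler_wpM2r // subr_ge0.
have fsurj y : exists x, f x = y.
  set M := `|y| / m.
  have M0 : 0 <= M by rewrite divr_ge0 // ltW.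
  have mM : m * M = `|y| by rewrite mulrC divfK // gt_eqF.
  have fM : y <= f M.
    by have := grow 0 M M0; rewrite f0 !subr0 mM; apply: le_trans; exact: ler_norm.
  have fNM : f (- M) <= y.
    have := grow (- M) 0; rewrite f0 oppr_le0 M0 sub0r opprK add0r mM => /(_ isT).
    by have := lerNnormlW (lexx `|y|); lra.
  have [|||x _ fx] := @IVT R f (- M) M y.
  - by lra.
  - exact: continuous_subspaceT.
  - by rewrite ge_min le_max fNM fM orbT.
  by exists x.
have [g gP] := choice fsurj.
have gK : cancel f g by move=> x; apply: finj; rewrite gP.
exists g; split=> // y.
rewrite -{1}(gP y); apply: is_derive_inverse.
- by near=> z; exact: gK.
- by near=> z; exact: fcont.
- by rewrite gt_eqF // (lt_le_trans m0).
Unshelve. all: by end_near.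
Qed.

(** [(u^2 + d^2) exp (- 4 y)] is nonincreasing, since [2 |u| (|u| + d) <= 4 (u^2 + d^2)]; squares
    avoid differentiating [|u|]. The same [d] bounds the initial gap and the forcing. *)
Lemma gronwall u du (M d : R) : 0 < d -> 
  (forall x, is_derive x (1 : R) u (du x)) ->
  (forall x, 0 <= x <= M -> `|du x| <= `|u x| + d) -> `|u 0| <= d ->
  forall x, 0 <= x <= M -> `|u x| <= 2 * d * expR (2 * M).
Proof.
move=> d0 ud udu u0 x /andP[x0 xM].
pose w y := - ((u y * u y + d * d) * expR (- (4 * y))).
pose dw y := (4 * (u y * u y + d * d) - 2 * (u y * du y)) * expR (- (4 * y)).
have wd y : is_derive y (1 : R) w (dw y).
  have := ud y => ?; rewrite /w /dw; apply: is_derive_eq.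
  rewrite /GRing.scale /=; ring.
have : w 0 <= w x.
  apply: (is_derive_ge0_le x0 (fun y _ => wd y)) => y /andP[y0 yx].
  rewrite /dw mulr_ge0 ?expR_ge0 // subr_ge0.
  have : u y * du y <= `|u y| * (`|u y| + d).
    apply: le_trans (ler_norm _) _; rewrite normrM ler_wpM2l // udu //.
    by rewrite y0 (le_trans yx).
  have -> : u y * u y = `|u y| * `|u y| by rewrite -normrM ger0_norm // -expr2 sqr_ge0.
  have := sqr_ge0 (`|u y| - d); nra.
rewrite /w lerN2 mulr0 oppr0 expR0 mulr1 => wle.
have u02 : u 0 * u 0 <= d * d.
  have -> : u 0 * u 0 = `|u 0| * `|u 0| by rewrite -normrM ger0_norm // -expr2 sqr_ge0.
  exact: ler_pM.
have le2 : u x * u x + d * d <= (2 * d * expR (2 * M)) * (2 * d * expR (2 * M)).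
  have -> : u x * u x + d * d = (u x * u x + d * d) * expR (- (4 * x)) * expR (4 * x).
    by rewrite -mulrA -expRD addNr expR0 mulr1.
  have eE : expR (4 * x) <= expR (2 * M) * expR (2 * M) by rewrite -expRD ler_expR; lra.
  apply: le_trans (ler_wpM2r (expR_ge0 _) wle) _.
  have -> : 2 * d * expR (2 * M) * (2 * d * expR (2 * M)) =
     (4 * d * d) * (expR (2 * M) * expR (2 * M)) by ring.
  by apply: ler_pM; rewrite ?expR_ge0 //; nra.
rewrite -ler_sqr ?nnegrE ?mulr_ge0 ?expR_ge0 ?(ltW d0) //.
by rewrite -normrX ger0_norm ?sqr_ge0 // !expr2; nra.
Qed.

End Calculus.

(** * Global primitives of continuous functions *)

Section Primitive.
Context {R : realType}.
Notation mu := (@lebesgue_measure R).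

Lemma continuous_integrable (f : R -> R) (a b : R) : continuous f ->
  mu.-integrable `[a, b] (EFin \o f).
Proof.
move=> fc; apply: continuous_compact_integrable; first exact: segment_compact.
exact: continuous_subspaceT.
Qed.

(** [P N] is a primitive on []- N, N[], and two of them agree where both are defined. The radius
    [|x| + 1] makes the choice global; near a given [x] it is exchanged for the fixed radius
    [|x| + 2]. *)
Lemma continuous_primitive (f : R -> R) : continuous f ->
  exists F : R -> R, F 0 = 0 /\ forall x, is_derive x (1 : R) F (f x).
Proof.
move=> fc.
pose P (N x : R) := \int[mu]_(t in `[- N, x]) f t - \int[mu]_(t in `[- N, 0]) f t.
have Pd (N x : R) : - N < x < N -> is_derive x (1 : R) (P N) (f x).
  move=> /andP[Nx xN].
  have [d e] := @continuous_FTC1_closed R f (- N) x N xN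
    (@continuous_integrable f (- N) N fc) Nx (fc x).
  have D : is_derive x (1 : R) (fun y => \int[mu]_(t in `[- N, y]) f t) (f x).
    by rewrite -e derive1E; exact: derivableP.
  by rewrite /P; apply: is_derive_eq; rewrite subr0.
have P0 (N : R) : P N 0 = 0 by rewrite /P subrr.
have PE (N M x : R) : `|x| < N -> `|x| < M -> P N x = P M x.
  rewrite !ltr_norml => /andP[Nx xN] /andP[Mx xM].
  pose d y := P N y - P M y.
  have dd (y : R) : Num.min 0 x <= y <= Num.max 0 x -> is_derive y (1 : R) d 0.
    move=> yx.
    have D1 : is_derive y (1 : R) (P N) (f y).
      by apply: Pd; move: yx; rewrite ge_min le_max => /andP[/orP[] ? /orP[] ?]; lra.
    have D2 : is_derive y (1 : R) (P M) (f y).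
      by apply: Pd; move: yx; rewrite ge_min le_max => /andP[/orP[] ? /orP[] ?]; lra.
    by rewrite /d; apply: is_derive_eq; rewrite subrr.
  have mM : Num.min 0 x <= Num.max 0 x by rewrite ge_min !le_max lexx.
  have [c _] := is_derive_MVT mM dd; rewrite mul0r.
  have d0 : d 0 = 0 by rewrite /d !P0 subrr.
  by case: (leP 0 x) => _; rewrite d0 /d => ?; lra.
exists (fun x => P (`|x| + 1) x); split=> [|x]; first by rewrite P0.
have D : is_derive x (1 : R) (P (`|x| + 2)) (f x).
  by apply: Pd; rewrite -ltr_norml ltrDl.
apply: near_eq_is_derive D.
near=> y; apply: PE; last by rewrite ltrDl.
have : `|x - y| < 1 by near: y; apply: (@cvgr_dist_lt _ _ _ _ _ id).
by have := ler_normB x (x - y); rewrite subKr; lra.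
Unshelve. all: by end_near.
Qed.

End Primitive.

(** * The chain rule for H1 functions *)

Section RealIntegrable.
Context {R : realType}.
Notation mu := (@lebesgue_measure R).
Implicit Types (D : set R) (f g : R -> R).

Lemma integrable_add D f g : measurable D ->
  mu.-integrable D (EFin \o f) -> mu.-integrable D (EFin \o g) ->
  mu.-integrable D (EFin \o (fun x => f x + g x)).
Proof.
move=> mD fi gi.
suff -> : EFin \o (fun x => f x + g x) = ((EFin \o f) \+ (EFin \o g))%E by exact: integrableD.
exact/funext.
Qed.

Lemma integrable_sub D f g : measurable D ->
  mu.-integrable D (EFin \o f) -> mu.-integrable D (EFin \o g) ->
  mu.-integrable D (EFin \o (fun x => f x - g x)).
Proof.
move=> mD fi gi.
suff -> : EFin \o (fun x => f x - g x) = ((EFin \o f) \- (EFin \o g))%E by exact: integrableB.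
exact/funext.
Qed.

Lemma integrable_scale D (k : R) f : measurable D ->
  mu.-integrable D (EFin \o f) -> mu.-integrable D (EFin \o (fun x => k * f x)).
Proof.
move=> mD fi.
suff -> : EFin \o (fun x => k * f x) = (fun x => k%:E * (EFin \o f) x)%E by exact: integrableZl.
exact/funext.
Qed.

Lemma integrable_cst_itv (a b : bool) (x y k : R) :
  mu.-integrable [set` Interval (BSide a x) (BSide b y)] (EFin \o (fun=> k)).
Proof.
apply: measurable_bounded_integrable => //.
- by rewrite /= lebesgue_measure_itv /=; case: ifP => //= _; rewrite -EFinB ltry.
- by exists `|k|; split; [exact: num_real|move=> M kM z _ /=; exact: ltW].
Qed.

Lemma integrable_bounded_mul D (k : R) f g : measurable D -> measurable_fun D f ->
  (forall x, D x -> `|f x| <= k) -> mu.-integrable D (EFin \o g) ->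
  mu.-integrable D (EFin \o (fun x => f x * g x)).
Proof.
move=> mD mf fk gi.
apply: (@le_integrable _ _ _ mu D mD _ (EFin \o (fun x => k * g x))); last exact: integrable_scale.
  apply/measurable_EFinP/measurable_funM => //.
  by apply/measurable_EFinP; exact: measurable_int gi.
move=> x Dx /=; rewrite lee_fin !normrM ler_wpM2r //.
by apply: le_trans (fk x Dx) (ler_norm _).
Qed.

End RealIntegrable.

Section ChainRule.
Context {R : realType}.
Notation mu := (@lebesgue_measure R).

(** Cut [[0, X]] into [n + 1] equal pieces: the increments of [E] telescope and the total variation
    of [D] over the pieces is at most [k X (E X - E 0) / (n + 1)]. This replaces differentiation
    almost everywhere in the chain rule. *)
Lemma superadditive_increment_cst (D E : R -> R) (k X : R) : 0 <= X ->
  (forall a b, 0 <= a -> a <= b -> b <= X ->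
    `|D b - D a| <= k * (b - a) * (E b - E a)) -> D X = D 0.
Proof.
move=> X0 DE.
have step (n : nat) (i : nat) : (i <= n.+1)%N ->
    `|D (i%:R * (X / n.+1%:R)) - D 0| <=
      k * (X / n.+1%:R) * (E (i%:R * (X / n.+1%:R)) - E 0).
  set s := X / n.+1%:R.
  have s0 : 0 <= s by rewrite divr_ge0.
  elim: i => [_|i IH ilt]; first by rewrite mul0r !subrr normr0 mulr0.
  have le1 : i.+1%:R * s <= X.
    rewrite /s mulrCA ler_piMr // ler_pdivrMr // mul1r ler_nat //.
  have := DE (i%:R * s) (i.+1%:R * s); rewrite mulr_ge0 // => /(_ isT).
  rewrite ler_wpM2r ?ler_nat // le1 => /(_ isT isT).
  have -> : i.+1%:R * s - i%:R * s = s by rewrite -natr1; ring.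
  have := IH (ltnW ilt).
  have := ler_normD (D (i.+1%:R * s) - D (i%:R * s)) (D (i%:R * s) - D 0).
  by rewrite addrA subrK; lra.
have lim (n : nat) : n.+1%:R * `|D X - D 0| <= k * X * (E X - E 0).
  have := step n n.+1 (leqnn _).
  have n0 : (n.+1%:R : R) != 0 by rewrite pnatr_eq0.
  rewrite mulrCA divff // mulr1 => h.
  apply: le_trans (ler_wpM2l (ler0n _ _) h) _.
  by rewrite le_eqVlt; apply/orP; left; apply/eqP; field.
apply/eqP; rewrite -subr_eq0 -normr_eq0 eq_le normr_ge0 andbT leNgt.
apply/negP => dpos.
set e := `|D X - D 0| in lim dpos *.
set m := k * X * (E X - E 0) in lim.
have := lim (Num.truncn (`|m| / e)).
rewrite leNgt => /negP; apply; rewrite -ltr_pdivrMr //.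
apply: le_lt_trans (truncnS_gt _).
by rewrite ler_pM2r ?invr_gt0 // ler_norm.
Qed.

(** Cauchy-Schwarz against the constant 1, read off from the integral of [(l |f| - d)^2 >= 0] with
    [l = b - a] and [d] the integral of [|f|]. *)
Lemma sqr_Rintegral_norm_le (f : R -> R) (a b : R) : a <= b ->
  mu.-integrable `]a, b] (EFin \o f) ->
  mu.-integrable `]a, b] (EFin \o (fun x => f x ^+ 2)) ->
  (\int[mu]_(x in `]a, b]) `|f x|) ^+ 2 <= (b - a) * \int[mu]_(x in `]a, b]) f x ^+ 2.
Proof.
rewrite le_eqVlt => /predU1P[<- _ _|ab fi f2i].
  by rewrite set_itv_ge ?bnd_simp ?ltxx // !Rintegral_set0 subrr mul0r expr0n.
set d := \int[mu]_(x in _) `|f x|; set e := \int[mu]_(x in _) _.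
set l := b - a; have l0 : 0 < l by rewrite subr_gt0.
have nfi : mu.-integrable `]a, b] (EFin \o (fun x => `|f x|)) by exact: integrable_norm.
have : 0 <= \int[mu]_(x in `]a, b]) ((l * l) * f x ^+ 2 - ((2 * l * d) * `|f x| - d * d)).
  apply: Rintegral_ge0 => x _.
  have -> : f x ^+ 2 = `|f x| ^+ 2 by rewrite -normrX ger0_norm ?sqr_ge0.
  by have := sqr_ge0 (l * `|f x| - d); nra.
have mI : measurable (`]a, b] : set R) by [].
rewrite RintegralB //; last 2 first.
- exact: integrable_scale.
- by apply: integrable_sub => //; [exact: integrable_scale|exact: integrable_cst_itv].
rewrite RintegralB //; last 2 first.
- exact: integrable_scale.
- exact: integrable_cst_itv.
rewrite !RintegralZl ?Rintegral_cst //=; last exact: integrable_cst_itv.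
rewrite lebesgue_measure_itv /= lte_fin ab -EFinB /=.
rewrite -/d -/e -/l => h.
have : 0 <= l * (l * e - d ^+ 2) by rewrite expr2; nra.
by rewrite pmulr_rge0 // subr_ge0.
Qed.

Lemma H1_integrable (psi h : R -> R) (A : set R) : H1 psi h -> measurable A -> A `<=` `[0, 1] ->
  mu.-integrable A (EFin \o h) /\ mu.-integrable A (EFin \o (fun x => h x ^+ 2)).
Proof.
by move=> [_ [hi [h2i _]]] mA A01; split; [apply: integrableS hi|apply: integrableS h2i].
Qed.

Lemma H1_measurable (psi h : R -> R) : H1 psi h -> measurable_fun (`[0, 1] : set R) psi.
Proof.
move=> [_ [hi [_ psiE]]].
suff c : {within `[0, 1], continuous psi} by exact: subspace_continuous_measurable_fun.
have pc := parameterized_integral_continuous ler01 hi.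
pose p x := psi 0 + \int[mu]_(t in `[0, x]) h t.
have eqp : {in `[0, 1]%classic, p =1 psi}.
  by move=> x; rewrite inE /= in_itv /= => x01; rewrite [RHS]psiE.
apply: (subspace_eq_continuous eqp).
by move=> x; apply: cvgD; [exact: cvg_cst|exact: pc].
Qed.

Lemma Rintegral_itv_increment (f : R -> R) (a b : R) : 0 <= a -> a <= b -> b <= 1 ->
  mu.-integrable `[0, 1] (EFin \o f) ->
  \int[mu]_(t in `[0, b]) f t - \int[mu]_(t in `[0, a]) f t = \int[mu]_(t in `]a, b]) f t.
Proof.
move=> a0 ab b1 fi; rewrite Rintegral_itvB ?bnd_simp //.
by apply: integrableS fi => //; apply: subset_itv; rewrite ?bnd_simp.
Qed.

(** On a short interval the mean value theorem gives [G (psi b) - G (psi a) = f xi * (psi b - psi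
    a)], so the defect [D] of the chain rule changes by the integral of [(f xi - f (psi t)) h t].
    This is at most [2 k] times the square of the integral of [|h|], hence at most [2 k (b - a)]
    times the integral of [h^2], and such increments force [D] to be constant. *)
Lemma H1_chain_rule (f G psi h : R -> R) (k B : R) :
  (forall x, is_derive x (1 : R) G (f x)) ->
  (forall x y, `|f x - f y| <= k * `|x - y|) -> (forall x, `|f x| <= B) ->
  H1 psi h -> 
  mu.-integrable `[0, 1] (EFin \o (fun t => f (psi t) * h t)) /\
  forall x, 0 <= x <= 1 -> \int[mu]_(t in `[0, x]) (f (psi t) * h t) = G (psi x) - G (psi 0).
Proof.
move=> Gd flip fB psiH.
have k0 : 0 <= k by have := flip 1 0; rewrite subr0 normr1 mulr1; exact: le_trans.
have fc : continuous f.
  move=> x; apply/cvgrPdist_lt => e e0; near=> y.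
  apply: le_lt_trans (flip _ _) _.
  apply: (@le_lt_trans _ _ ((k + 1) * `|x - y|)); first by rewrite ler_wpM2r // lerDl.
  rewrite mulrC -ltr_pdivlMr ?ltr_wpDl //.
  near: y; apply: (@cvgr_dist_lt _ _ _ _ _ id) => //.
  by rewrite divr_gt0 // ltr_wpDl.
have mfpsi : measurable_fun (`[0, 1] : set R) (fun t => f (psi t)).
  apply: (measurableT_comp (continuous_measurable_fun fc)); exact: H1_measurable psiH.
have [hi h2i] := H1_integrable psiH (measurable_itv `[0, 1]) (@subset_refl _ _).
have fhi : mu.-integrable `[0, 1] (EFin \o (fun t => f (psi t) * h t)).
  by apply: (@integrable_bounded_mul _ _ B) => //.
split=> // x /andP[x0 x1].
pose E y := \int[mu]_(t in `[0, y]) (h t ^+ 2).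
pose D y := G (psi y) - \int[mu]_(t in `[0, y]) (f (psi t) * h t).
suff : D x = D 0.
  by rewrite /D set_itv1 Rintegral_set1 subr0 => <-; rewrite subKr.
apply: (@superadditive_increment_cst D E (2 * k)) => // a b a0 ab bx.
have b1 := le_trans bx x1.
have sub (c d : R) : a <= c -> d <= b -> `]c, d] `<=` (`[0, 1] : set R).
  by move=> ac db; apply: subset_itv; rewrite bnd_simp; [exact: le_trans ac|exact: le_trans b1].
have psiB c d : 0 <= c -> c <= d -> d <= 1 -> psi d - psi c = \int[mu]_(t in `]c, d]) h t.
  move=> c0 cd d1; rewrite -Rintegral_itv_increment //.
  case: psiH => [_ [_ [_ psiE]]].
  rewrite (psiE d) ?(psiE c) ?d1 ?c0 ?(le_trans c0) ?(le_trans cd) //; lra.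
have mI (c d : R) : measurable (`]c, d] : set R) by [].
have hab c d : a <= c -> d <= b -> mu.-integrable `]c, d] (EFin \o h).
  by move=> ac db; apply: integrableS hi => //; exact: sub.
set dl := \int[mu]_(t in `]a, b]) `|h t|.
have psidl t : a <= t -> t <= b -> `|psi t - psi a| <= dl.
  move=> at_ tb; rewrite psiB ?(le_trans tb) //.
  apply: le_trans (le_normr_Rintegral _ (hab _ _ _ _)) _ => //.
  rewrite -subr_ge0 /dl Rintegral_itvB ?bnd_simp //.
    by apply: Rintegral_ge0.
  exact/integrable_norm/hab.
(* [xi] is a value between [psi a] and [psi b], so it obeys the same oscillation bound [dl] as every
   [psi t] on [[a, b]]. *)
have [xi xidl GE] : exists2 xi, `|xi - psi a| <= dl & 
    G (psi b) - G (psi a) = f xi * (psi b - psi a).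
  have hb := psidl b ab (lexx _).
  case: (leP (psi a) (psi b)) => pab.
    have [c /andP[c1 c2] ->] := is_derive_MVT pab (fun z _ => Gd z).
    exists c => //; apply: le_trans hb; rewrite !ger0_norm ?subr_ge0 //; lra.
  have [c /andP[c1 c2] e] := is_derive_MVT (ltW pab) (fun z _ => Gd z).
  exists c; last by lra.
  apply: le_trans hb; rewrite !ler0_norm ?subr_le0 //; first lra.
  exact: ltW.
have -> : D b - D a = \int[mu]_(t in `]a, b]) ((f xi - f (psi t)) * h t).
  transitivity (\int[mu]_(t in `]a, b]) (f xi * h t - f (psi t) * h t)); last first.
    by apply: eq_Rintegral => t _; rewrite mulrBl.
  rewrite RintegralB //; last 2 first.
  - by apply: integrable_scale => //; exact: hab.
  - by apply: integrableS fhi => //; exact: sub.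
  rewrite RintegralZl //; last exact: hab.
  by rewrite -psiB // -GE -Rintegral_itv_increment // /D; lra.
have ifxi : mu.-integrable `]a, b] (EFin \o (fun t => (f xi - f (psi t)) * h t)).
  apply: (@integrable_bounded_mul _ _ (2 * B)) => //.
  - apply: measurable_funB => //.
    by apply: measurable_funS mfpsi => //; exact: sub.
  - move=> t _; have := ler_normB (f xi) (f (psi t)); have := fB xi; have := fB (psi t); lra.
  - exact: hab.
apply: le_trans (le_normr_Rintegral _ ifxi) _ => //.
have inh : mu.-integrable `]a, b] (EFin \o (fun t => `|h t|)) by exact/integrable_norm/hab.
apply: (@le_trans _ _ (\int[mu]_(t in `]a, b]) (2 * k * dl * `|h t|))).
  apply: le_Rintegral => //; first exact: integrable_norm.
    exact: integrable_scale.
  move=> t; rewrite /= in_itv /= => /andP[at_ tb]; rewrite normrM ler_wpM2r //.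
  apply: le_trans (flip _ _) _; rewrite [2 * k]mulrC -mulrA ler_wpM2l //.
  have := psidl t (ltW at_) tb; have := ler_normB (xi - psi a) (psi t - psi a).
  by rewrite opprB addrA subrK; lra.
rewrite RintegralZl // -/dl -!mulrA ler_wpM2l // ler_wpM2l //.
rewrite -expr2 /E Rintegral_itv_increment //.
apply: sqr_Rintegral_norm_le => //; first exact: hab.
by apply: integrableS h2i => //; exact: sub.
Unshelve. all: by end_near.
Qed.

End ChainRule.

(** * The speed of the flow and the energy as a function of the end value *)

Section Speed.
Context {R : realType}.
Implicit Types (c t x y : R).

(** For [c > 0], [c] is [beta] times the slope of the flow line at its starting value 0, since [sin]
    vanishes there. *)
Definition speed c t : R := Num.sqrt (c ^+ 2 + sin t ^+ 2).

Lemma speed_ge0 c t : 0 <= speed c t.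
Proof. exact: sqrtr_ge0. Qed.

Lemma sqr_speed c t : speed c t ^+ 2 = c ^+ 2 + sin t ^+ 2.
Proof. by rewrite sqr_sqrtr // addr_ge0 ?sqr_ge0. Qed.

Lemma speed_ge_sin c t : `|sin t| <= speed c t.
Proof. by rewrite -sqrtr_sqr ler_wsqrtr // lerDr sqr_ge0. Qed.

Lemma speed_ge c t : 0 <= c -> c <= speed c t.
Proof. by move=> c0; rewrite -{1}(ger0_norm c0) -sqrtr_sqr ler_wsqrtr // lerDl sqr_ge0. Qed.

Lemma speed_gt0 c t : 0 < c -> 0 < speed c t.
Proof. by move=> c0; apply: lt_le_trans c0 (speed_ge _ (ltW c0)). Qed.

Lemma speed_le c t : 0 <= c -> speed c t <= c + `|sin t|.
Proof.
move=> c0; rewrite -ler_sqr ?nnegrE ?speed_ge0 ?addr_ge0 // sqr_speed.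
rewrite -(real_normK (num_real (sin t))) !expr2.
by have := normr_ge0 (sin t); nra.
Qed.

Lemma speedDpi c t : speed c (t + pi) = speed c t.
Proof. by rewrite /speed sinDpi sqrrN. Qed.

Lemma is_derive_speed c t : 0 < c ->
  is_derive t (1 : R) (speed c) (sin t * cos t / speed c t).
Proof.
move=> c0; have h : 0 < c ^+ 2 + sin t ^+ 2 by rewrite ltr_wpDr ?sqr_ge0 // exprn_gt0.
have := is_derive1_sqrt h => ?.
have n0 : speed c t != 0 by rewrite gt_eqF // speed_gt0.
rewrite /speed; apply: is_derive_eq; rewrite -/(speed c t) /GRing.scale /=.
by field.
Qed.

Lemma speed_lipschitz c x y : 0 < c -> `|speed c x - speed c y| <= 1 * `|x - y|.
Proof.
move=> c0; apply: (is_derive_lipschitz (fun t => is_derive_speed t c0)) => t.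
have s0 := speed_gt0 t c0.
rewrite normrM normfV (gtr0_norm s0) ler_pdivrMr // mul1r normrM.
apply: le_trans (speed_ge_sin c t); rewrite -[leRHS]mulr1 ler_wpM2l //.
exact: cos_max.
Qed.

Lemma speed_bounded c t : 0 < c -> `|speed c t| <= c + 1.
Proof.
move=> c0; rewrite ger0_norm ?speed_ge0 //; have := speed_le t (ltW c0).
by have := sin_max t; lra.
Qed.

Lemma inv_speed_bounded c t : 0 < c -> `|(speed c t)^-1| <= c^-1.
Proof.
move=> c0; rewrite gtr0_norm ?invr_gt0 ?speed_gt0 // lef_pV2 ?posrE ?speed_gt0 //.
by rewrite speed_ge // ltW.
Qed.

Lemma inv_speed_lipschitz c x y : 0 < c ->
  `|(speed c x)^-1 - (speed c y)^-1| <= c ^- 2 * `|x - y|.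
Proof.
move=> c0; have sx := speed_gt0 x c0; have sy := speed_gt0 y c0.
have -> : (speed c x)^-1 - (speed c y)^-1 =
    ((speed c x)^-1 * (speed c y)^-1) * (speed c y - speed c x).
  by field; rewrite !gt_eqF.
rewrite normrM ler_pM //.
  by rewrite normrM expr2 invfM ler_pM // inv_speed_bounded.
by rewrite distrC; have := speed_lipschitz x y c0; rewrite mul1r.
Qed.

Lemma continuous_speed c : 0 < c -> continuous (speed c).
Proof. by move=> c0; apply: is_derive_continuous => t; exact: is_derive_speed. Qed.

Lemma continuous_inv_speed c : 0 < c -> continuous (fun t => (speed c t)^-1).
Proof.
move=> c0 t; apply: cvgV; last exact: continuous_speed.
by rewrite gt_eqF // speed_gt0.
Qed.

(** On [[0, pi]] the derivative [speed c t - k] of [J] is nonpositive up to [T0], nonnegative up to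
    [pi - T0], then nonpositive again, so only [T0] and [pi] compete. Since the speed dominates
    [sin], [G pi >= 2 >= k pi], whence [J pi >= J 0 >= J T0]. By periodicity of the speed the same
    jump gives [J t <= J (t + pi)], which reduces any [T] to the first period. *)
Lemma endpoint_energy_min (G : R -> R) c (k T0 T : R) : 0 <= c ->
  (forall t, is_derive t (1 : R) G (speed c t)) -> G 0 = 0 -> k * pi <= 2 ->
  0 <= T0 <= pi / 2 -> speed c T0 = k -> 0 <= T ->
  G T0 - k * T0 <= G T - k * T.
Proof.
move=> c0 Gd G0 kpi /andP[T0ge T0le] sk.
have pi0 := @pi_gt0 R.
pose J t := G t - k * t.
have Jd t : is_derive t (1 : R) J (speed c t - k).
  by have := Gd t => ?; rewrite /J; apply: is_derive_eq; rewrite /GRing.scale /=; ring.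
have sinmono x y : 0 <= x -> x <= y -> y <= pi / 2 -> speed c x <= speed c y.
  move=> x0 xy ypi; rewrite ler_wsqrtr // lerD2l ler_sqr ?nnegrE ?sin_ge0_pi //; last 2 first.
  - by apply/andP; split=> //; lra.
  - by apply/andP; split; lra.
  move: xy; rewrite le_eqVlt => /predU1P[-> //|xy].
  by apply: ltW; rewrite ltr_sin // in_itv /=; apply/andP; split; lra.
have speedB x : speed c (pi - x) = speed c x.
  by rewrite /speed [pi - x]addrC sinDpi sinN opprK.
have Jincr x y : T0 <= x -> x <= y -> y <= pi - T0 -> J x <= J y.
  move=> Tx xy yT; apply: (is_derive_ge0_le xy (fun t _ => Jd t)) => t /andP[xt ty].
  rewrite subr_ge0 -sk; case: (leP t (pi / 2)) => tpi.
    by apply: sinmono => //; lra.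
  by rewrite -(speedB t); apply: sinmono => //; lra.
have Jdecr x y : x <= y -> (forall t, x <= t <= y -> speed c t <= k) -> J y <= J x.
  move=> xy st.
  have Jd' t : x <= t <= y -> is_derive t (1 : R) (fun t => - J t) (k - speed c t).
    by move=> _; have := Jd t => ?; apply: is_derive_eq; rewrite opprB.
  rewrite -lerN2; apply: (is_derive_ge0_le xy Jd') => t /st; lra.
have Gpi : 2 <= G pi.
  have Gc t : 0 <= t <= pi -> is_derive t (1 : R) (fun t => G t + cos t) (speed c t - sin t).
    by move=> _; have := Gd t => ?; apply: is_derive_eq.
  have := is_derive_ge0_le (ltW pi0) Gc.
  rewrite G0 cos0 cospi => h.
  suff : 0 + 1 <= G pi - 1 by lra.
  apply: h => t _; rewrite subr_ge0.
  exact: le_trans (ler_norm _) (speed_ge_sin c t).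
have Jpi t : J t <= J (t + pi).
  have D u : is_derive u (1 : R) (fun t => G (t + pi) - G t) 0.
    have := Gd u => ?; have : is_derive (u + pi) (1 : R) G (speed c (u + pi)) by [].
    move=> ?; apply: is_derive_eq; rewrite speedDpi; ring.
  have := is_derive_0_is_cst t 0 D; rewrite add0r G0 /J; lra.
have J00 : J T0 <= J 0.
  apply: Jdecr => // t /andP[t0 tT]; rewrite -sk; exact: sinmono.
have base t : 0 <= t -> t <= pi -> J T0 <= J t.
  move=> t0 tpi; case: (leP t T0) => tT.
    apply: Jdecr => // s /andP[ts sT]; rewrite -sk; apply: sinmono => //; lra.
  case: (leP t (pi - T0)) => tT'; first by apply: Jincr => //; lra.
  have : J pi <= J t.
    apply: Jdecr => // s /andP[ts spi]; rewrite -sk -(speedB s); apply: sinmono => //; lra.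
  by have := Jpi 0; rewrite add0r; lra.
move=> Tge.
have [n] : exists n : nat, T <= n.+1%:R * pi.
  exists (Num.truncn (T / pi)); rewrite -ler_pdivrMr //; apply: ltW; exact: truncnS_gt.
elim: n T Tge => [|n IH] t t0; first by rewrite mul1r => /(base t t0).
move=> tn; case: (leP t pi) => tpi; first exact: base.
have : J T0 <= J (t - pi).
  by apply: IH; [lra|move: tn; rewrite -[n.+2%:R]natr1; lra].
by have := Jpi (t - pi); rewrite subrK /J; lra.
Qed.

End Speed.

(** * Calibration of the energy *)

Section Energy.
Context {R : realType}.
Notation mu := (@lebesgue_measure R).
Implicit Types (beta kappa c : R) (psi h phi G L : R -> R).

Lemma H1_opp psi h : admissible psi h -> admissible (fun x => - psi x) (fun x => - h x).
Proof.
move=> [[mh [hi [h2i psiE]]] psi0]; split; last by rewrite psi0 oppr0.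
split; first exact: measurable_funN.
have mI : measurable (`[0, 1] : set R) by [].
have nE : (fun x => - h x) = (fun x => -1 * h x) by apply/funext => x; rewrite mulN1r.
split; first by rewrite nE; exact: integrable_scale.
split; first by under [X in integrable _ _ X]eq_fun do rewrite sqrrN.
move=> x x01; rewrite psiE // nE RintegralZl //; first by rewrite opprD mulN1r.
apply: integrableS hi => //; apply: subset_itv; rewrite bnd_simp //.
by case/andP: x01.
Qed.

Lemma admissible_end psi h : admissible psi h -> \int[mu]_(x in `[0, 1]) h x = psi 1.
Proof.
by move=> [[_ [_ [_ psiE]]] psi0]; rewrite (psiE 1) ?ler01 ?lexx // psi0 add0r.
Qed.

(** Only the linear term sees the sign. With [kappa > 0], reflection strictly lowers the energy of a
    function with negative end value, so competitors may be assumed to end at a nonnegative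
    value. *)
Lemma F_opp beta kappa psi h : admissible psi h ->
  F beta kappa (fun x => - psi x) (fun x => - h x) = F beta kappa psi h + kappa * psi 1.
Proof.
move=> adm; rewrite /F (admissible_end adm) (admissible_end (H1_opp adm)).
under eq_Rintegral do rewrite sqrrN sinN sqrrN.
by field.
Qed.

Definition defect beta c psi h : R :=
  \int[mu]_(x in `[0, 1]) (h x - speed c (psi x) / beta) ^+ 2.

Lemma defect_ge0 beta c psi h : 0 <= defect beta c psi h.
Proof. by apply: Rintegral_ge0 => x _; exact: sqr_ge0. Qed.

Lemma measurable_comp_H1 psi h (f : R -> R) : H1 psi h -> continuous f ->
  measurable_fun (`[0, 1] : set R) (fun x => f (psi x)).
Proof.
move=> psiH fc; apply: (measurableT_comp (continuous_measurable_fun fc)).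
exact: H1_measurable psiH.
Qed.

Lemma defect_integrable beta c psi h : 0 < c -> H1 psi h ->
  mu.-integrable `[0, 1] (EFin \o (fun x => h x - speed c (psi x) / beta)) /\
  mu.-integrable `[0, 1] (EFin \o (fun x => (h x - speed c (psi x) / beta) ^+ 2)).
Proof.
move=> c0 psiH.
have mI : measurable (`[0, 1] : set R) by [].
have [hi h2i] := H1_integrable psiH mI (@subset_refl _ _).
have mg := measurable_comp_H1 psiH (continuous_speed c0).
have gB x : (`[0, 1]%classic : set R) x -> `|speed c (psi x)| <= c + 1.
  by move=> _; exact: speed_bounded.
have gi : mu.-integrable `[0, 1] (EFin \o (fun x => speed c (psi x))).
  have := integrable_bounded_mul mI mg gB (@integrable_cst_itv R true false 0 1 1).
  by under [X in integrable _ _ X -> _]eq_fun do rewrite mulr1.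
have ggi := integrable_bounded_mul mI mg gB gi.
have ghi := integrable_bounded_mul mI mg gB hi.
split.
  have := integrable_sub mI hi (integrable_scale beta^-1 mI gi).
  by under [X in integrable _ _ X -> _]eq_fun do rewrite [_^-1 * _]mulrC.
have := integrable_add mI (integrable_sub mI h2i (integrable_scale (2 / beta) mI ghi))
  (integrable_scale (beta^-1 * beta^-1) mI ggi).
congr (integrable _ _ _); apply/funext => x /=; congr EFin.
by rewrite !expr2; ring.
Qed.

Lemma F_calibration beta kappa c psi h G : 0 < beta -> 0 < c ->
  (forall t, is_derive t (1 : R) G (speed c t)) -> G 0 = 0 -> admissible psi h ->
  F beta kappa psi h = 8^-1 * defect beta c psi h
    + (G (psi 1) - 2 * (kappa * beta) * psi 1) / (4 * beta) - c ^+ 2 / (8 * beta ^+ 2).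
Proof.
move=> b0 c0 Gd G0 adm; have [psiH psi0] := adm.
have mI : measurable (`[0, 1] : set R) by [].
have [_ di] := defect_integrable beta c0 psiH.
have [ghi /(_ 1)] := H1_chain_rule Gd (fun x y => speed_lipschitz x y c0)
  (fun x => speed_bounded x c0) psiH.
rewrite ler01 lexx psi0 G0 subr0 => /(_ isT) chain.
rewrite /F (admissible_end adm).
have -> : \int[mu]_(x in `[0, 1]) (h x ^+ 2 + sin (psi x) ^+ 2 / beta ^+ 2) =
  \int[mu]_(x in `[0, 1]) ((h x - speed c (psi x) / beta) ^+ 2 +
     (2 / beta * (speed c (psi x) * h x) - c ^+ 2 / beta ^+ 2)).
  apply: eq_Rintegral => x _.
  have -> : sin (psi x) ^+ 2 = speed c (psi x) ^+ 2 - c ^+ 2 by rewrite sqr_speed addrC addKr.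
  by field; rewrite gt_eqF.
have ki := @integrable_cst_itv R true false 0 1 (c ^+ 2 / beta ^+ 2).
have sghi := integrable_scale (2 / beta) mI ghi.
rewrite RintegralD //; last exact: integrable_sub.
have zE : \int[mu]_(x in `[0, 1]) (2 / beta * (speed c (psi x) * h x)) = 2 / beta * G (psi 1).
  by rewrite -chain; apply: RintegralZl.
rewrite RintegralB // zE Rintegral_cst //= lebesgue_measure_itv /=.
rewrite lte_fin ltr01 -EFinB /= -/(defect beta c psi h) subr0.
by field; rewrite gt_eqF.
Qed.

(** The equation [h = speed c psi / beta] holds only almost everywhere, so it is used in integrated
    form. By Cauchy-Schwarz the remainder [q] has zero integral of [|q|]; the chain rule for [L]
    writes [L (psi x)] as the integral of [h / speed = 1 / beta + q / speed], and
    [1 / speed <= 1 / c] discards the second term. *)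
Lemma defect0_flow beta c psi h L : 0 < beta -> 0 < c -> admissible psi h ->
  (forall t, is_derive t (1 : R) L (speed c t)^-1) -> L 0 = 0 -> defect beta c psi h = 0 ->
  forall x, 0 <= x <= 1 -> L (psi x) = x / beta.
Proof.
move=> b0 c0 [psiH psi0] Ld L0 d0 x x01.
have /andP[x0 x1] := x01.
have mI : measurable (`[0, 1] : set R) by [].
have mx : measurable (`[0, x] : set R) by [].
have sx : (`[0, x]%classic : set R) `<=` `[0, 1] by apply: subset_itv; rewrite bnd_simp.
have s01 : (`]0, 1]%classic : set R) `<=` `[0, 1] by apply: subset_itv; rewrite bnd_simp.
pose q t := h t - speed c (psi t) / beta.
have [qi q2i] := defect_integrable beta c0 psiH.
have nqi : mu.-integrable `[0, 1] (EFin \o (fun t => `|q t|)) by exact: integrable_norm.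
have q2i0 : \int[mu]_(t in `]0, 1]) (q t ^+ 2) = 0.
  by rewrite -Rintegral_itv_increment // set_itv1 Rintegral_set1 subr0.
have q0 : \int[mu]_(t in `[0, 1]) `|q t| = 0.
  have := @sqr_Rintegral_norm_le R q 0 1 ler01.
  rewrite q2i0 mulr0 -Rintegral_itv_increment // set_itv1 Rintegral_set1 subr0 => h0.
  apply/eqP; rewrite -sqrf_eq0 eq_le sqr_ge0 andbT.
  by apply: h0; [exact: integrableS qi|exact: integrableS q2i].
have [fhi /(_ x x01)] := H1_chain_rule Ld (fun x y => inv_speed_lipschitz x y c0)
  (fun x => inv_speed_bounded x c0) psiH.
rewrite psi0 L0 subr0 => <-.
apply/eqP; rewrite -subr_eq0 -normr_eq0 eq_le normr_ge0 andbT.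
have ki := @integrable_cst_itv R true false 0 x beta^-1.
have kE : x / beta = \int[mu]_(t in `[0, x]) beta^-1.
  rewrite Rintegral_cst //= lebesgue_measure_itv /= lte_fin; case: ltP => // [xp|x0'].
    by rewrite -EFinB /= subr0 mulrC.
  have -> : x = 0 by apply/eqP; rewrite eq_le x0 x0'.
  by rewrite mul0r mulr0.
have fhix : mu.-integrable `[0, x] (EFin \o (fun t => (speed c (psi t))^-1 * h t)).
  exact: integrableS fhi.
rewrite kE -RintegralB //.
apply: le_trans (le_normr_Rintegral _ (integrable_sub mx fhix ki)) _ => //.
have nqix : mu.-integrable `[0, x] (EFin \o (fun t => `|q t|)) by exact: integrableS nqi.
apply: (@le_trans _ _ (\int[mu]_(t in `[0, x]) (c^-1 * `|q t|))).
  apply: le_Rintegral => //.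
  - by apply: integrable_norm; exact: integrable_sub.
  - exact: integrable_scale.
  move=> t _.
  have s0 := speed_gt0 (psi t) c0.
  have -> : (speed c (psi t))^-1 * h t - beta^-1 = (speed c (psi t))^-1 * q t.
    by rewrite /q; field; rewrite !gt_eqF.
  by rewrite normrM ler_wpM2r // inv_speed_bounded.
rewrite RintegralZl // mulr_ge0_le0 ?invr_ge0 ?(ltW c0) //.
suff : 0 <= \int[mu]_(t in `[0, 1]) `|q t| - \int[mu]_(t in `[0, x]) `|q t|.
  by rewrite q0 sub0r oppr_ge0.
rewrite Rintegral_itvB ?bnd_simp //.
exact: Rintegral_ge0.
Qed.

Lemma flow_admissible beta c phi : 0 < c -> phi 0 = 0 ->
  (forall x, is_derive x (1 : R) phi (speed c (phi x) / beta)) ->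
  admissible phi (fun x => speed c (phi x) / beta).
Proof.
move=> c0 phi0 phid.
have gc : continuous (fun x => speed c (phi x) / beta).
  move=> x; apply: cvgMl.
  apply: (@continuous_comp _ _ _ phi (speed c)); first exact: is_derive_continuous phid x.
  exact: continuous_speed.
split=> //; split; first by apply: measurable_funTS; exact: continuous_measurable_fun.
split; first exact: continuous_integrable.
split.
  apply: (@continuous_integrable R (fun x => (speed c (phi x) / beta) ^+ 2)).
  under eq_fun do rewrite expr2.
  by move=> x; apply: cvgM; exact: gc.
move=> x /andP[x0 x1]; rewrite phi0 add0r.
move: x0; rewrite le_eqVlt => /predU1P[<-|x0]; first by rewrite set_itv1 Rintegral_set1.
rewrite /Rintegral (@continuous_FTC2 _ _ phi) //.
- by rewrite phi0 sube0.
- exact: continuous_subspaceT.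
- have phic := is_derive_continuous phid; split.
  + by move=> y _; exact: (@ex_derive _ _ _ _ _ _ _ (phid y)).
  + by apply: cvg_at_right_filter; exact: phic.
  + by apply: cvg_at_left_filter; exact: phic.
- by move=> y _; rewrite derive1E; exact: (@derive_val _ _ _ _ _ _ _ (phid y)).
Qed.

Lemma flow_minimizer beta kappa c phi G : 0 < beta -> 0 < kappa -> 0 < c ->
  kappa * beta * pi <= 1 -> phi 0 = 0 -> 0 <= phi 1 <= pi / 2 ->
  (forall x, is_derive x (1 : R) phi (speed c (phi x) / beta)) ->
  speed c (phi 1) = 2 * (kappa * beta) ->
  (forall t, is_derive t (1 : R) G (speed c t)) -> G 0 = 0 ->
  [/\ is_minimizer beta kappa phi (fun x => speed c (phi x) / beta),
    (forall psi h, is_minimizer beta kappa psi h -> forall x, 0 <= x <= 1 -> psi x = phi x) &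
    F beta kappa phi (fun x => speed c (phi x) / beta) =
      (G (phi 1) - 2 * (kappa * beta) * phi 1) / (4 * beta) - c ^+ 2 / (8 * beta ^+ 2)].
Proof.
move=> b0 k0 c0 kb phi0 phi1 phid phis Gd G0.
have adm := flow_admissible c0 phi0 phid.
have FE : F beta kappa phi (fun x => speed c (phi x) / beta) =
      (G (phi 1) - 2 * (kappa * beta) * phi 1) / (4 * beta) - c ^+ 2 / (8 * beta ^+ 2).
  rewrite (F_calibration kappa b0 c0 Gd G0 adm).
  suff -> : defect beta c phi (fun x => speed c (phi x) / beta) = 0 by rewrite mulr0 add0r.
  rewrite /defect; under eq_Rintegral do rewrite subrr expr0n /=.
  by rewrite Rintegral_cst //= mul0r.
(* In the calibrated form the end value contributes least at [phi 1], so the excess energy is at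
   least an eighth of the defect. Minimality and uniqueness both follow from this. *)
have gap psi h : admissible psi h -> 0 <= psi 1 ->
    8^-1 * defect beta c psi h <= F beta kappa psi h - F beta kappa phi (fun x => speed c (phi x) / beta).
  move=> ad psi1; rewrite FE (F_calibration kappa b0 c0 Gd G0 ad).
  have := endpoint_energy_min (ltW c0) Gd G0 _ phi1 phis psi1.
  have -> : 2 * (kappa * beta) * pi <= 2 = true by apply/idP; lra.
  move=> /(_ isT) le; rewrite -subr_ge0.
  set d := defect _ _ _ _; set a := G (psi 1) - _ in le *; set b := G (phi 1) - _ in le *.
  have -> : 8^-1 * d + a / (4 * beta) - c ^+ 2 / (8 * beta ^+ 2) -
    (b / (4 * beta) - c ^+ 2 / (8 * beta ^+ 2)) - 8^-1 * d = (a - b) / (4 * beta).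
    by field; rewrite gt_eqF.
  by rewrite divr_ge0 ?subr_ge0 // mulr_ge0 // ltW.
have minF psi h : admissible psi h ->
    F beta kappa phi (fun x => speed c (phi x) / beta) <= F beta kappa psi h.
  move=> ad; case: (leP 0 (psi 1)) => psi1.
    by have := gap _ _ ad psi1; have := defect_ge0 beta c psi h; lra.
  have adN := H1_opp ad.
  have := gap _ _ adN; rewrite /= oppr_ge0 (ltW psi1) F_opp // => /(_ isT).
  by have := defect_ge0 beta c (fun x => - psi x) (fun x => - h x); nra.
split=> // psi h [ad psimin] x x01.
have psi1 : 0 <= psi 1.
  rewrite leNgt; apply/negP => psi1.
  by have := psimin _ _ (H1_opp ad); rewrite F_opp //; nra.
have d0 : defect beta c psi h = 0.
  have := gap _ _ ad psi1; have := psimin _ _ adm; have := defect_ge0 beta c psi h; lra.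
(* [L] is the travel time along the flow divided by [beta]. Both functions have the same travel time
   at [x], and [L] is strictly increasing. *)
have [L [L0 Ld]] := continuous_primitive (continuous_inv_speed c0).
have psix := defect0_flow b0 c0 ad Ld L0 d0 x01.
have phix : L (phi x) = x / beta.
  have D y : is_derive y (1 : R) (fun y => L (phi y) - y / beta) 0.
    have := phid y => ?; have := Ld (phi y) => ?.
    apply: is_derive_eq; rewrite /GRing.scale /=; field.
    by rewrite !gt_eqF ?speed_gt0.
  by have := is_derive_0_is_cst x 0 D; rewrite phi0 L0; lra.
have : `|psi x - phi x| <= 0.
  rewrite leNgt normr_gt0 subr_eq0; apply/negP => ne.
  have Linj (y z : R) : y < z -> L y < L z.
    move=> yz; apply: (is_derive_gt0_lt yz (fun t _ => Ld t)) => t _.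
    by rewrite invr_gt0 speed_gt0.
  by case/lt_total/orP: ne => /Linj; rewrite psix phix ltxx.
by rewrite normr_le0 subr_eq0 => /eqP.
Qed.

End Energy.

(** * Shooting *)

Section Shooting.
Context {R : realType}.
Implicit Types (c d t k beta : R).

Lemma sin_le_id t : 0 <= t -> sin t <= t.
Proof.
move=> t0.
have D x : 0 <= x <= t -> is_derive x (1 : R) (fun x => x - sin x) (1 - cos x).
  by move=> _; apply: is_derive_eq.
have := is_derive_ge0_le t0 D; rewrite sin0 => h.
suff : 0 - 0 <= t - sin t by lra.
by apply: h => x _; rewrite subr_ge0 cos_le1.
Qed.

Lemma norm_sin_le t : `|sin t| <= `|t|.
Proof.
wlog t0 : t / 0 <= t.
  by move=> H; case: (leP 0 t) => [/H //|/ltW t0]; rewrite -normrN -sinN -[leRHS]normrN H // oppr_ge0.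
rewrite [leRHS]ger0_norm // ler_norml sin_le_id // andbT.
case: (leP t pi) => tpi.
  by apply: le_trans (sin_ge0_pi _); rewrite ?t0 ?oppr_le0.
have := sin_geN1 t; have := @pi_ge2 R; lra.
Qed.

(** The difference of the squared speeds is [(c - d) (c + d)], and the sum of the speeds is at least
    [c + d]. *)
Lemma speed_param_lipschitz c d t : 0 < c -> 0 < d -> `|speed c t - speed d t| <= `|c - d|.
Proof.
move=> c0 d0; have sc := speed_ge t (ltW c0); have sd := speed_ge t (ltW d0).
have E : (speed c t - speed d t) * (speed c t + speed d t) = (c - d) * (c + d).
  by rewrite -!subr_sqr !sqr_speed; ring.
have cd0 : 0 < c + d by rewrite addr_gt0.
rewrite -(ler_pM2r cd0) -[in leRHS](gtr0_norm cd0) -normrM -E normrM ler_wpM2l //.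
by rewrite ger0_norm; lra.
Qed.

Lemma inv_speed_param_lipschitz c d m t : 0 < m -> m <= c -> m <= d ->
  `|(speed c t)^-1 - (speed d t)^-1| <= m ^- 2 * `|c - d|.
Proof.
move=> m0 mc md; have c0 := lt_le_trans m0 mc; have d0 := lt_le_trans m0 md.
have sc := speed_gt0 t c0; have sd := speed_gt0 t d0.
have -> : (speed c t)^-1 - (speed d t)^-1 =
    ((speed c t)^-1 * (speed d t)^-1) * (speed d t - speed c t).
  by field; rewrite !gt_eqF.
rewrite normrM ler_pM //; last by rewrite distrC speed_param_lipschitz.
rewrite normrM expr2 invfM ler_pM //.
  by apply: le_trans (inv_speed_bounded t c0) _; rewrite lef_pV2.
by apply: le_trans (inv_speed_bounded t d0) _; rewrite lef_pV2.
Qed.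

(** Since [speed c x <= c + x], the travel time grows at least logarithmically as [c] tends to 0.
    This supplies the long travel times needed at the lower end of the shooting interval. *)
Lemma log_le_primitive (L : R -> R) c t : 0 < c -> L 0 = 0 -> 0 <= t ->
  (forall t, is_derive t (1 : R) L (speed c t)^-1) -> ln (c + t) - ln c <= L t.
Proof.
move=> c0 L0 t0 Ld.
have D x : 0 <= x <= t -> is_derive x (1 : R) (fun x => L x - ln (c + x))
    ((speed c x)^-1 - (c + x)^-1).
  move=> /andP[x0 _]; have cx : 0 < c + x by rewrite ltr_pwDl.
  have := Ld x => ?; have := is_derive1_ln cx => ?.
  by apply: is_derive_eq; rewrite add0r mulr1.
have := is_derive_ge0_le t0 D; rewrite L0 addr0 => h.
suff : 0 - ln c <= L t - ln (c + t) by lra.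
apply: h => x /andP[x0 _]; rewrite subr_ge0 lef_pV2 ?posrE ?speed_gt0 ?ltr_pwDl //.
apply: le_trans (speed_le x (ltW c0)) _; rewrite lerD2l.
by apply: le_trans (norm_sin_le x) _; rewrite ger0_norm.
Qed.

(** For each [c] the end condition prescribes the end value [T c], where [sin] equals
    [sqrt (k^2 - c^2)]. What remains is to reach it at time 1, that is [L c (T c) = 1 / beta]. This
    quantity is 0 at [c = k] and large for small [c]; the intermediate value theorem gives [c], and
    inverting [L c] gives the flow. *)
Lemma flow_exists beta k : 0 < beta -> 0 < k < 1 ->
  exists c (phi : R -> R), [/\ 0 < c <= k, phi 0 = 0, 0 < phi 1 < pi / 2,
    sin (phi 1) = Num.sqrt (k ^+ 2 - c ^+ 2) &
    forall x, is_derive x (1 : R) phi (speed c (phi x) / beta)].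
Proof.
move=> b0 /andP[k0 k1].
have Lex c : exists L : R -> R, 0 < c ->
    L 0 = 0 /\ forall t, is_derive t (1 : R) L (speed c t)^-1.
  case: (leP c 0) => [_|c0]; first by exists id.
  by have [L LP] := continuous_primitive (continuous_inv_speed c0); exists L.
have [L LP] := choice Lex.
have Linc c x y : 0 < c -> x < y -> L c x < L c y.
  move=> c0 xy; have [_ Ld] := LP c c0.
  apply: (is_derive_gt0_lt xy (fun t _ => Ld t)) => t _.
  by rewrite invr_gt0 speed_gt0.
(* The root of a negative number is 0, so [s], and with it [T], is defined and continuous for every
   [c], beyond [k] as well. *)
pose s c := Num.sqrt (k ^+ 2 - c ^+ 2).
have s01 c : 0 <= s c <= k.
  rewrite sqrtr_ge0 /= -ler_sqr ?nnegrE ?sqrtr_ge0 ?(ltW k0) //.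
  case: (leP 0 (k ^+ 2 - c ^+ 2)) => h; first by rewrite sqr_sqrtr // gerBl sqr_ge0.
  by rewrite /s ltr0_sqrtr // expr0n /= sqr_ge0.
have sN11 c : -1 < s c < 1 by have /andP[] := s01 c; move=> *; apply/andP; split; lra.
have sN11' c : -1 <= s c <= 1 by have /andP[] := sN11 c; move=> *; apply/andP; split; lra.
pose T c := asin (s c).
have Tle c : `|T c| <= 2.
  rewrite ler_norml; have := asin_geNpi2 (sN11' c); have := asin_lepi2 (sN11' c).
  by rewrite -/(T c); have := @pihalf_lt2 R; move=> *; apply/andP; split; lra.
have Tcont : continuous T.
  move=> c; apply: (@continuous_comp _ _ _ s (@asin R)); last exact: continuous_asin.
  apply: (@continuous_comp _ _ _ (fun c => k ^+ 2 - c ^+ 2) (@Num.sqrt R)).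
    apply: (@is_derive_continuous R _ (fun c => - (2 * c))) => x.
    by apply: is_derive_eq; rewrite /GRing.scale /=; ring.
  exact: sqrt_continuous.
(* Chosen so that [ln (k / 2) - ln m = 1 / beta]. As [m < k / 2], also [T m >= sin (T m) >= k / 2],
   and the logarithmic bound gives a travel time of at least 1. *)
pose m := k / 2 * expR (- beta^-1).
have E1 : expR (- beta^-1) < 1 by rewrite expR_lt1 oppr_lt0 invr_gt0.
have m0 : 0 < m by rewrite mulr_gt0 ?expR_gt0 ?divr_gt0.
have mk2 : m < k / 2 by rewrite /m gtr_pMr // divr_gt0.
have mk : m <= k by lra.
(* The maximum keeps the parameter away from 0, so that two-sided continuity also makes sense at
   [m]. *)
pose Lam c := L (Num.max m c) (T c).
have Lamc c : m <= c -> {for c, continuous Lam}.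
  (* Joint continuity is split: [L c (T d)] varies only the end point, while [Lam d - L c (T d)]
     varies only the parameter and is controlled by the Lipschitz dependence of the inverse speed on
     it, over the bounded range of [T]. *)
  move=> mc; have c0 := lt_le_trans m0 mc.
  have -> : Lam = (fun d => (Lam d - L c (T d)) + L c (T d)).
    by apply/funext => d; rewrite subrK.
  have L1 : L c (T d) @[d --> c] --> Lam c.
    rewrite /Lam (max_idPr mc).
    apply: (@continuous_comp _ _ _ T (L c)); first exact: Tcont.
    exact: (is_derive_continuous (LP c c0).2).
  have L2 : (Lam d - L c (T d)) @[d --> c] --> 0.
    have mm : 0 < m ^- 2 * 2 by rewrite mulr_gt0 // invr_gt0 exprn_gt0.
    apply/cvgr0Pnorm_lt => e e0; near=> d.
    have md : m <= Num.max m d by rewrite le_max lexx.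
    have dl : `|Lam d - L c (T d)| <= m ^- 2 * `|Num.max m d - c| * 2.
      have [L0d Ldd] := LP _ (lt_le_trans m0 md); have [L0c Lcd] := LP c c0.
      have D t : is_derive t (1 : R) (fun t => L (Num.max m d) t - L c t)
          ((speed (Num.max m d) t)^-1 - (speed c t)^-1).
        by have := Ldd t => ?; have := Lcd t => ?; apply: is_derive_eq.
      have := is_derive_lipschitz D (fun t => inv_speed_param_lipschitz t m0 md mc) (T d) 0.
      rewrite L0d L0c !subr0 => h; apply: le_trans h _.
      by rewrite ler_wpM2l // mulr_ge0 // invr_ge0 sqr_ge0.
    apply: le_lt_trans dl _.
    have : `|Num.max m d - c| <= `|d - c|.
      case: (leP m d) => [//|dm]; rewrite distrC [leRHS]distrC !ger0_norm; lra.
    move=> h; apply: (@le_lt_trans _ _ (m ^- 2 * 2 * `|c - d|)).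
      by rewrite [`|c - d|]distrC -!mulrA ler_wpM2l ?invr_ge0 ?sqr_ge0 // mulrC ler_wpM2l.
    rewrite mulrC -ltr_pdivlMr //.
    near: d; apply: (@cvgr_dist_lt _ _ _ _ _ id) => //.
    exact: divr_gt0.
  have : (Lam d - L c (T d) + L c (T d)) @[d --> c] --> 0 + Lam c by exact: cvgD.
  by rewrite add0r -[X in _ --> X](subrK (L c (T c))).
have sinT c : sin (T c) = s c by rewrite asinK // in_itv /= sN11'.
have T0 c : 0 <= T c.
  rewrite leNgt; apply/negP => Tn.
  have : 0 < sin (- T c).
    apply: sin_gt0_pi; have := asin_geNpi2 (sN11' c); rewrite -/(T c).
    by have := @pi_gt0 R; move=> *; apply/andP; split; lra.
  by rewrite sinN sinT oppr_gt0; have /andP[] := s01 c; lra.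
have Lamk : Lam k = 0.
  by rewrite /Lam (max_idPr mk) /T /s subrr sqrtr0 -sin0 sinK ?sin0 ?(LP k k0).1 // in_itv /=;
    have := @pi_gt0 R; move=> *; apply/andP; split; lra.
have Lamm : beta^-1 <= Lam m.
  rewrite /Lam maxxx.
  have [L0 Ld] := LP m m0.
  apply: le_trans (log_le_primitive m0 L0 (T0 m) Ld).
  have Tm : k / 2 <= T m.
    apply: le_trans (sin_le_id (T0 m)); rewrite sinT.
    rewrite -ler_sqr ?nnegrE ?sqrtr_ge0 ?divr_ge0 ?(ltW k0) //.
    rewrite sqr_sqrtr; rewrite ?subr_ge0 ?ler_sqr ?nnegrE ?(ltW k0) ?(ltW m0) //.
    by rewrite !expr2; nra.
  have : ln (k / 2) <= ln (m + T m) by rewrite ler_ln ?posrE ?divr_gt0 //; lra.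
  have : ln m = ln (k / 2) - beta^-1 by rewrite /m lnM ?posrE ?expR_gt0 ?divr_gt0 // expRK.
  lra.
have [||c cmk Lamc1] := @IVT R Lam m k beta^-1 mk.
- apply: continuous_in_subspaceT => c; rewrite inE /= in_itv /= => /andP[mc _].
  exact: Lamc.
- by rewrite Lamk ge_min le_max Lamm invr_ge0 (ltW b0) orbT.
move: cmk; rewrite in_itv /= => /andP[mc ck].
have c0 := lt_le_trans m0 mc.
move: Lamc1; rewrite /Lam (max_idPr mc) => LT.
have [L0 Ld] := LP c c0.
have c1 : 0 < (c + 1)^-1 by rewrite invr_gt0; lra.
have Lge t : (c + 1)^-1 <= (speed c t)^-1.
  rewrite lef_pV2 ?posrE ?speed_gt0 //; last by lra.
  by have := speed_bounded t c0; rewrite ger0_norm ?speed_ge0.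
have [A [LA AL Ad]] := increasing_derivative_inverse c1 L0 Ld Lge.
exists c, (fun x => A (x / beta)).
have A1 : A (1 / beta) = T c by rewrite div1r -LT AL.
split=> //.
- by rewrite c0.
- by rewrite mul0r -L0 AL.
- rewrite A1; apply/andP; split; last by apply: asin_ltpi2; have /andP[/ltW ->] := sN11 c.
  rewrite lt_def T0 andbT; apply/eqP => Tc0; move: LT; rewrite Tc0 L0 => /eqP.
  by rewrite eq_sym invr_eq0 gt_eqF.
- by rewrite A1 sinT.
- move=> x; have := Ad (x / beta) => ?.
  by apply: is_derive_eq; rewrite invrK /GRing.scale /=; ring.
Unshelve. all: by end_near.
Qed.

End Shooting.

(** * Monotonicity, separatrix comparison and exponential smallness of the flow *)

Section FlowBounds.
Context {R : realType}.

(** [k] stands for [2 kappa beta]. Estimates that depend on these data alone are uniform in the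
    relation between [kappa] and [beta], so they serve both regimes. [fd_sin] encodes the end
    condition [speed c (phi 1) = k]. *)
Record flow_data (beta k c : R) (phi : R -> R) : Prop := FlowData {
  fd_beta : 0 < beta;
  fd_c : 0 < c;
  fd_ck : c <= k;
  fd_k : k < 1;
  fd_0 : phi 0 = 0;
  fd_1 : 0 < phi 1 < pi / 2;
  fd_sin : sin (phi 1) = Num.sqrt (k ^+ 2 - c ^+ 2);
  fd_ode : forall x, is_derive x (1 : R) phi (speed c (phi x) / beta) }.

Lemma sin_sub_le (x : R) : 0 <= x <= pi -> x * cos x <= sin x.
Proof.
move=> /andP[x0 xpi].
have D y : 0 <= y <= x -> is_derive y (1 : R) (fun y => sin y - y * cos y) (y * sin y).
  by move=> _; apply: is_derive_eq; rewrite /GRing.scale /=; ring.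
have := is_derive_ge0_le x0 D; rewrite sin0 mul0r subrr => h.
suff : 0 <= sin x - x * cos x by lra.
apply: h => y /andP[y0 yx]; rewrite mulr_ge0 // sin_ge0_pi // y0 /=; lra.
Qed.

Lemma cos_lipschitz (x y : R) : `|cos x - cos y| <= `|x - y|.
Proof.
rewrite -[leRHS]mul1r; apply: (@is_derive_lipschitz R cos (fun x => - sin x)) => // z.
by rewrite normrN sin_max.
Qed.

Lemma sin_lipschitz (x y : R) : `|sin x - sin y| <= `|x - y|.
Proof.
rewrite -[leRHS]mul1r; apply: (@is_derive_lipschitz R sin cos) => // z.
exact: cos_max.
Qed.

Lemma atan_le_id (y : R) : 0 <= y -> atan y <= y.
Proof.
move=> y0.
have D x : 0 <= x <= y -> is_derive x (1 : R) (fun x => x - atan x) (1 - (1 + x ^+ 2)^-1).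
  by move=> _; apply: is_derive_eq.
have := is_derive_ge0_le y0 D; rewrite atan0 => h.
suff : 0 - 0 <= y - atan y by lra.
apply: h => x _; rewrite subr_ge0 invf_le1; first by rewrite lerDl sqr_ge0.
by rewrite ltr_wpDr ?sqr_ge0.
Qed.

Lemma half_mulr2n (t : R) : (t / 2) *+ 2 = t.
Proof. by rewrite mulr2n; lra. Qed.

(** [sin t = (1 + cos t) tan (t / 2)], and [cos t >= 0] on this range. *)
Lemma tan_half_le_sin (t : R) : 0 <= t <= pi / 2 -> 0 <= tan (t / 2) <= sin t.
Proof.
move=> /andP[t0 tpi]; have pi0 := @pi_gt0 R.
have c0 : 0 < cos (t / 2) by apply: cos_gt0_pihalf; apply/andP; split; lra.
have s0 : 0 <= sin (t / 2) by apply: sin_ge0_pi; apply/andP; split; lra.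
rewrite /tan divr_ge0 ?(ltW c0) //= ler_pdivrMr //.
have -> : sin t = (cos (t / 2) * sin (t / 2)) *+ 2.
  by rewrite -sin_mulr2n half_mulr2n.
have : 0 <= cos t by apply: cos_ge0_pihalf; apply/andP; split; lra.
have -> : cos t = cos (t / 2) ^+ 2 *+ 2 - 1 by rewrite -cos_mulr2n half_mulr2n.
rewrite !mulr2n expr2; nra.
Qed.

Variables (beta k c : R) (phi : R -> R).
Hypothesis fd : flow_data beta k c phi.

Let b0 := fd_beta fd.
Let c0 := fd_c fd.

Lemma flow_k_gt0 : 0 < k.
Proof. exact: lt_le_trans c0 (fd_ck fd). Qed.

Lemma flow_increasing x y : x < y -> phi x < phi y.
Proof.
move=> xy; apply: (is_derive_gt0_lt xy (fun t _ => fd_ode fd t)) => t _.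
by rewrite divr_gt0 // speed_gt0.
Qed.

Lemma flow_nondecreasing x y : x <= y -> phi x <= phi y.
Proof. by rewrite le_eqVlt => /predU1P[-> //|/flow_increasing /ltW]. Qed.

Lemma flow_range x : 0 <= x <= 1 -> 0 <= phi x <= phi 1.
Proof. by move=> /andP[x0 x1]; rewrite -{1}(fd_0 fd) !flow_nondecreasing. Qed.

Lemma flow_range_pihalf x : 0 <= x <= 1 -> 0 <= phi x <= pi / 2.
Proof. by move=> /flow_range /andP[? ?]; have /andP[_ ?] := fd_1 fd; apply/andP; split; lra. Qed.

Lemma flow_range_strict x : 0 < x < 1 -> 0 < phi x < pi / 2.
Proof.
move=> /andP[x0 x1]; rewrite -{1}(fd_0 fd) flow_increasing //=.
by have /andP[_] := fd_1 fd; apply: lt_trans; exact: flow_increasing.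
Qed.

Lemma flow_end_speed : speed c (phi 1) = k.
Proof.
have k0 := ltW flow_k_gt0.
rewrite /speed (fd_sin fd) sqr_sqrtr; first by rewrite addrC subrK sqrtr_sqr ger0_norm.
by rewrite subr_ge0 ler_sqr ?nnegrE ?(ltW c0) // (fd_ck fd).
Qed.

Lemma flow_end_sin : k - c <= sin (phi 1) <= k.
Proof.
have k0 := flow_k_gt0; have ck := fd_ck fd; have c00 := c0.
apply/andP; split; last first.
  by rewrite -flow_end_speed; apply: le_trans (speed_ge_sin c (phi 1)); exact: ler_norm.
have := sqr_speed c (phi 1); rewrite flow_end_speed => e.
have s0 : 0 <= sin (phi 1) by rewrite (fd_sin fd) sqrtr_ge0.
rewrite -ler_sqr ?nnegrE ?subr_ge0 //; move: e; rewrite !expr2; nra.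
Qed.

(* [tan (phi / 2) * exp (- x / beta)] increases because [phi' > sin phi / beta]. *)
Lemma flow_lt_separatrix x : 0 <= x < 1 ->
  phi x < 2 * atan (tan (phi 1 / 2) * expR ((x - 1) / beta)).
Proof.
move=> /andP[x0 x1]; have pi0 := @pi_gt0 R.
pose z y := tan (phi y / 2) * expR (- (y / beta)).
pose dz y := ((cos (phi y / 2)) ^- 2 * (speed c (phi y) / beta / 2)
   - tan (phi y / 2) / beta) * expR (- (y / beta)).
have half y : x <= y <= 1 -> 0 <= phi y / 2 <= pi / 4.
  move=> /andP[xy y1]; have y01 : 0 <= y <= 1 by rewrite y1 (le_trans x0).
  have /andP[] := flow_range_pihalf y01.
  by move=> *; apply/andP; split; lra.
have cpos y : x <= y <= 1 -> 0 < cos (phi y / 2).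
  by move=> /half /andP[? ?]; apply: cos_gt0_pihalf; apply/andP; split; lra.
have zd y : x <= y <= 1 -> is_derive y (1 : R) z (dz y).
  move=> /cpos cy; have cn : cos (phi y / 2) != 0 by rewrite gt_eqF.
  have := fd_ode fd y => ?; have := is_derive_tan cn => ?.
  rewrite /z /dz; apply: is_derive_eq; rewrite /GRing.scale /=; ring.
have zlt : z x < z 1.
  apply: (is_derive_gt0_lt x1 zd) => y xy1.
  have cy := cpos y xy1; rewrite /dz mulr_gt0 ?expR_gt0 // subr_gt0.
  have y0 : 0 <= y by case/andP: xy1 => xy _; exact: le_trans xy.
  have sin2 : sin (phi y) = (cos (phi y / 2) * sin (phi y / 2)) *+ 2.
    by rewrite -sin_mulr2n half_mulr2n.
  have sp : sin (phi y) < speed c (phi y).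
    rewrite /speed; apply: (@le_lt_trans _ _ (Num.sqrt (sin (phi y) ^+ 2))).
      by rewrite sqrtr_sqr ler_norm.
    by rewrite ltr_sqrt ?ltrDr ?ltr_wpDr ?sqr_ge0 // exprn_gt0.
  rewrite /tan; set C := cos _ in cy sin2 *; set S := sin (phi y / 2) in sin2 *.
  have -> : S / C / beta = C ^- 2 * (sin (phi y) / beta / 2).
    by rewrite sin2 mulr2n; field; rewrite !gt_eqF.
  by rewrite ltr_pM2l ?invr_gt0 ?exprn_gt0 // !ltr_pM2r ?invr_gt0.
have tlt : tan (phi x / 2) < tan (phi 1 / 2) * expR ((x - 1) / beta).
  have -> : (x - 1) / beta = - (1 / beta) + x / beta by ring.
  rewrite expRD mulrA -ltr_pdivrMr ?expR_gt0 // -expRN; exact: zlt.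
have : atan (tan (phi x / 2)) < atan (tan (phi 1 / 2) * expR ((x - 1) / beta)).
  exact: lt_atan.
rewrite tanK; first by lra.
have xx : x <= x <= 1 by rewrite lexx ltW.
rewrite in_itv /=; have /andP[] := half x xx.
by move=> *; apply/andP; split; lra.
Qed.

(** The separatrix bound, an equality at [x = 1], is linearized by [atan y <= y] and
    [tan (phi 1 / 2) <= sin (phi 1) <= k]. The factor [k] is what makes the bound relative to the
    amplitude. *)
Lemma flow_le_exp x : 0 <= x <= 1 -> phi x <= 2 * k * expR ((x - 1) / beta).
Proof.
have pi0 := @pi_gt0 R.
have /andP[p1 p2] := fd_1 fd; have p12 : 0 <= phi 1 <= pi / 2 by rewrite !ltW.
have /andP[t0 tle] := tan_half_le_sin p12.
have tk : tan (phi 1 / 2) <= k by apply: le_trans tle _; have /andP[] := flow_end_sin.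
have key y : phi y <= 2 * atan (tan (phi 1 / 2) * expR ((y - 1) / beta)) ->
    phi y <= 2 * k * expR ((y - 1) / beta).
  have E0 := expR_ge0 ((y - 1) / beta).
  move=> h; apply: le_trans h _; rewrite -mulrA ler_wpM2l //.
  by apply: le_trans (atan_le_id _) _; [exact: mulr_ge0|exact: ler_wpM2r].
move=> /andP[x0]; rewrite le_eqVlt => /predU1P[->|x1]; apply: key; last first.
  by apply: ltW; apply: flow_lt_separatrix; rewrite x0.
rewrite subrr mul0r expR0 mulr1 tanK; first by lra.
by rewrite in_itv /=; apply/andP; split; lra.
Qed.

Lemma flow_end_le : phi 1 <= 2 * k.
Proof. by have := @flow_le_exp 1; rewrite subrr mul0r expR0 mulr1; apply; rewrite ler01 lexx. Qed.

(** The slope is at least [c / beta], so [c <= phi beta], and the exponential bound at [x = beta]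
    costs only a factor [expR 1]. *)
Lemma flow_c_le : beta <= 1 -> c <= 2 * expR 1 * k * expR (- beta^-1).
Proof.
move=> b1; have b00 := b0.
have : c <= phi beta.
  have [x _] := is_derive_MVT (ltW b0) (fun t _ => fd_ode fd t).
  rewrite (fd_0 fd) !subr0 => ->; rewrite divfK ?gt_eqF //; exact/speed_ge/ltW.
move=> /le_trans; apply; apply: le_trans (flow_le_exp _) _; first by rewrite ltW.
have -> : (beta - 1) / beta = 1 + - beta^-1 by field; rewrite gt_eqF.
by rewrite expRD le_eqVlt; apply/orP; left; apply/eqP; ring.
Qed.

End FlowBounds.

(** * Derivatives of all orders *)

Section Jets.
Context {R : realType}.

(** Polynomials are kept as syntax so that derivatives of every order can be computed symbolically,
    and bounded or compared by induction on the expression. *)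
Inductive jet : Type :=
  | Jp | Js | Jc | Je | Jopp of jet | Jadd of jet & jet | Jmul of jet & jet.

Fixpoint jet_eval (p s c e : R) (q : jet) : R :=
  match q with
  | Jp => p
  | Js => s
  | Jc => c
  | Je => e
  | Jopp q1 => - jet_eval p s c e q1
  | Jadd q1 q2 => jet_eval p s c e q1 + jet_eval p s c e q2
  | Jmul q1 q2 => jet_eval p s c e q1 * jet_eval p s c e q2
  end.

(** The derivation along the pendulum field, with the time scale factored out. The constant [e] has
    derivative 0, spelled [e - e] because the syntax has no numerals. *)
Fixpoint jet_D (q : jet) : jet :=
  match q with
  | Jp => Jmul Js Jc
  | Js => Jmul Jc Jp
  | Jc => Jopp (Jmul (Jmul Je Je) (Jmul Js Jp))
  | Je => Jadd Je (Jopp Je)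
  | Jopp q1 => Jopp (jet_D q1)
  | Jadd q1 q2 => Jadd (jet_D q1) (jet_D q2)
  | Jmul q1 q2 => Jadd (Jmul (jet_D q1) q2) (Jmul q1 (jet_D q2))
  end.

(* With [e = 1] this is the pendulum: [p = Phi'], [s = sin Phi], [c = cos Phi].  The
   parameter [e] is the amplitude of [Phi] after normalization, and [e = 0] gives the
   linearized equation [Phi'' = Phi]. *)
Record pendulum (lam e : R) (Phi p s c : R -> R) : Prop := Pendulum {
  pend_Phi : forall x, is_derive x (1 : R) Phi (lam * p x);
  pend_p : forall x, is_derive x (1 : R) p (lam * (s x * c x));
  pend_s : forall x, is_derive x (1 : R) s (lam * (c x * p x));
  pend_c : forall x, is_derive x (1 : R) c (lam * - (e * e * (s x * p x))) }.

Lemma is_derive_jet lam e Phi p s c : pendulum lam e Phi p s c -> forall q x,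
  is_derive x (1 : R) (fun x => jet_eval (p x) (s x) (c x) e q)
    (lam * jet_eval (p x) (s x) (c x) e (jet_D q)).
Proof.
move=> P q x; elim: q => [||||q IH|q1 IH1 q2 IH2|q1 IH1 q2 IH2] /=.
- exact: pend_p P x.
- exact: pend_s P x.
- exact: pend_c P x.
- by apply: is_derive_eq; rewrite subrr mulr0.
- by apply: is_derive_eq; rewrite mulrN.
- by apply: is_derive_eq; rewrite mulrDr.
- by apply: is_derive_eq; rewrite /GRing.scale /=; ring.
Qed.

Lemma is_derive_derive1 (f df : R -> R) : (forall x, is_derive x (1 : R) f (df x)) -> derive1 f = df.
Proof. by move=> fd; apply/funext => x; rewrite derive1E; exact: derive_val. Qed.

Lemma pendulum_derive1n lam e Phi p s c : pendulum lam e Phi p s c -> forall n,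
  derive1n n.+1 Phi = fun x => lam ^+ n.+1 * jet_eval (p x) (s x) (c x) e (iter n jet_D Jp).
Proof.
move=> P; elim=> [|n IH].
  by apply: is_derive_derive1 => x; rewrite expr1; exact: pend_Phi P x.
rewrite derive1nS IH; apply: is_derive_derive1 => x.
have := is_derive_jet P (iter n jet_D Jp) x => ?.
by apply: is_derive_eq; rewrite /GRing.scale /= [lam ^+ n.+2]exprSr; ring.
Qed.

Lemma pendulum_derivable lam e Phi p s c : pendulum lam e Phi p s c ->
  forall n x, derivable (derive1n n Phi) x 1.
Proof.
move=> P [|n] x; first exact: (@ex_derive _ _ _ _ _ _ _ (pend_Phi P x)).
rewrite (pendulum_derive1n P).
have := is_derive_jet P (iter n jet_D Jp) x => D.
by apply: derivableM; [exact: derivable_cst|exact: (@ex_derive _ _ _ _ _ _ _ D)].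
Qed.

Lemma jet_bounded q : exists B : R, 0 <= B /\ forall p s c e : R,
  `|p| <= 2 -> `|s| <= 2 -> `|c| <= 2 -> `|e| <= 2 -> `|jet_eval p s c e q| <= B.
Proof.
elim: q => [||||q [B [B0 IH]]|q1 [B1 [B10 IH1]] q2 [B2 [B20 IH2]]
  |q1 [B1 [B10 IH1]] q2 [B2 [B20 IH2]]] /=; try by exists 2.
- by exists B; split=> // *; rewrite normrN IH.
- exists (B1 + B2); split=> [|p s c e *]; first exact: addr_ge0.
  by apply: le_trans (ler_normD _ _) _; rewrite lerD ?IH1 ?IH2.
- exists (B1 * B2); split=> [|p s c e *]; first exact: mulr_ge0.
  by rewrite normrM ler_pM ?IH1 ?IH2.
Qed.

Lemma jet_lipschitz q : exists K : R, 1 <= K /\ forall p s c e p' s' c' e' d : R,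
  `|p| <= 2 -> `|s| <= 2 -> `|c| <= 2 -> `|e| <= 2 ->
  `|p'| <= 2 -> `|s'| <= 2 -> `|c'| <= 2 -> `|e'| <= 2 ->
  `|p - p'| <= d -> `|s - s'| <= d -> `|c - c'| <= d -> `|e - e'| <= d ->
  `|jet_eval p s c e q - jet_eval p' s' c' e' q| <= K * d.
Proof.
elim: q => [||||q [K [K1 IH]]|q1 [K1 [K11 IH1]] q2 [K2 [K21 IH2]]
  |q1 [K1 [K11 IH1]] q2 [K2 [K21 IH2]]] /=; try by exists 1; split=> // *; rewrite mul1r.
- by exists K; split=> // *; rewrite -opprD normrN IH.
- exists (K1 + K2); split=> [|p s c e p' s' c' e' d *]; first lra.
  rewrite opprD addrACA mulrDl.
  by apply: le_trans (ler_normD _ _) _; rewrite lerD ?IH1 ?IH2.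
- have [B1 [B10 H1]] := jet_bounded q1; have [B2 [B20 H2]] := jet_bounded q2.
  exists (K1 * B2 + B1 * K2 + 1); split=> [|p s c e p' s' c' e' d *].
    by rewrite lerDr addr_ge0 // mulr_ge0 //; lra.
  have d0 : 0 <= d by apply: (@le_trans _ _ `|p - p'|).
  set a := jet_eval p s c e q1; set b := jet_eval p s c e q2.
  set a' := jet_eval p' s' c' e' q1; set b' := jet_eval p' s' c' e' q2.
  have -> : a * b - a' * b' = (a - a') * b + a' * (b - b') by ring.
  apply: le_trans (ler_normD _ _) _; rewrite !normrM.
  have : `|a - a'| * `|b| <= (K1 * d) * B2 by rewrite ler_pM ?H2 ?IH1.
  have : `|a'| * `|b - b'| <= B1 * (K2 * d) by rewrite ler_pM ?H1 ?IH2.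
  by lra.
Qed.

(** [K] depends on [n] only, so a single comparison covers all three limits: the zero solution, the
    separatrix and the exponential. *)
Lemma pendulum_derive1n_close (n : nat) : exists K : R, 1 <= K /\
  forall lam e e' Phi p s c Phi' p' s' c' x d,
  pendulum lam e Phi p s c -> pendulum lam e' Phi' p' s' c' ->
  `|p x| <= 2 -> `|s x| <= 2 -> `|c x| <= 2 -> `|e| <= 2 ->
  `|p' x| <= 2 -> `|s' x| <= 2 -> `|c' x| <= 2 -> `|e'| <= 2 ->
  `|Phi x - Phi' x| <= d ->
  `|p x - p' x| <= d -> `|s x - s' x| <= d -> `|c x - c' x| <= d -> `|e - e'| <= d ->
  `|derive1n n Phi x - derive1n n Phi' x| <= `|lam| ^+ n * (K * d).
Proof.
case: n => [|n].
  by exists 1; split=> // *; rewrite expr0 !mul1r.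
have [K [K1 KP]] := jet_lipschitz (iter n jet_D Jp).
exists K; split=> // lam e e' Phi p s c Phi' p' s' c' x d P P' *.
rewrite (pendulum_derive1n P) (pendulum_derive1n P') -mulrBr normrM normrX.
by rewrite ler_wpM2l ?exprn_ge0 // KP.
Qed.

Lemma derive1n_cst (a : R) n (x : R) : derive1n n.+1 (fun=> a) x = 0.
Proof.
elim: n x => [|n IH] x.
  by rewrite derive1n1 derive1_cst.
by rewrite derive1nS (_ : derive1n n.+1 _ = fun=> 0) ?derive1_cst //; apply/funext.
Qed.

Lemma flow_pendulum (beta c : R) (phi : R -> R) : 0 < beta -> 0 < c ->
  (forall x, is_derive x (1 : R) phi (speed c (phi x) / beta)) ->
  pendulum beta^-1 1 phi (fun x => speed c (phi x)) (fun x => sin (phi x)) (fun x => cos (phi x)).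
Proof.
move=> b0 c0 phid; split=> x; have := phid x => D.
- by apply: is_derive_eq; rewrite mulrC.
- have := is_derive_speed (phi x) c0 => ?; apply: is_derive_eq.
  by field; rewrite !gt_eqF ?speed_gt0.
- by apply: is_derive_eq; ring.
- by apply: is_derive_eq; ring.
Qed.

(** Time runs backwards from the end point, hence the sign of the slope. The amplitude [e] will be 1
    for the profile of fixed size and [k] for the linearized one. *)
Lemma rescaled_flow_pendulum (beta c e : R) (phi : R -> R) : 0 < beta -> 0 < c -> 0 < e ->
  (forall x, is_derive x (1 : R) phi (speed c (phi x) / beta)) ->
  pendulum 1 e (fun y => phi (1 - beta * y) / e)
    (fun y => - speed c (phi (1 - beta * y)) / e)
    (fun y => sin (phi (1 - beta * y)) / e) (fun y => cos (phi (1 - beta * y))).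
Proof.
move=> b0 c0 e0 phid.
have D y : is_derive y (1 : R) (fun y => phi (1 - beta * y)) (- speed c (phi (1 - beta * y))).
  have := phid (1 - beta * y) => ?; apply: is_derive_eq; rewrite /GRing.scale /=.
  by field; rewrite gt_eqF.
split=> y; have := D y => ?.
- by apply: is_derive_eq; rewrite /GRing.scale /=; ring.
- have := is_derive_speed (phi (1 - beta * y)) c0 => ?; apply: is_derive_eq.
  by rewrite /GRing.scale /=; field; rewrite !gt_eqF ?speed_gt0.
- by apply: is_derive_eq; rewrite /GRing.scale /=; ring.
- by apply: is_derive_eq; field; rewrite gt_eqF.
Qed.

Lemma exp_pendulum : pendulum 1 0 (fun y => expR (- y)) (fun y => - expR (- y))
  (fun y => expR (- y)) (fun=> 1).
Proof. by split=> y; apply: is_derive_eq; ring. Qed.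

Lemma sin_2atan (q : R) : sin (2 * atan q) = 2 * q / (1 + q ^+ 2).
Proof.
have h : 0 < 1 + q ^+ 2 by rewrite ltr_wpDr ?sqr_ge0.
have cn : cos (atan q) != 0 by rewrite cos_atan invr_eq0 gt_eqF // sqrtr_gt0.
have sE : sin (atan q) = q * cos (atan q) by rewrite -{2}(atanK q) /tan divfK.
have -> : 2 * atan q = (atan q) *+ 2 by rewrite mulr_natl.
rewrite sin_mulr2n sE mulr2n.
have c2 : cos (atan q) * cos (atan q) = (1 + q ^+ 2)^-1.
  by rewrite -expr2 cos_atan exprVn sqr_sqrtr // ltW.
have -> : cos (atan q) * (q * cos (atan q)) = q * (cos (atan q) * cos (atan q)) by ring.
by rewrite c2; field; rewrite gt_eqF.
Qed.

Lemma separatrix_pendulum (q : R) (psi0 := fun y : R => 2 * atan (q * expR (- y))) :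
  (forall y, is_derive y (1 : R) psi0 (- sin (psi0 y))) /\
  pendulum 1 1 psi0 (fun y => - sin (psi0 y)) (fun y => sin (psi0 y)) (fun y => cos (psi0 y)).
Proof.
have D y : is_derive y (1 : R) psi0 (- sin (psi0 y)).
  rewrite /psi0 sin_2atan; apply: is_derive_eq; rewrite /GRing.scale /=.
  by field; rewrite gt_eqF // ltr_wpDr ?sqr_ge0.
by split=> //; split=> y; have := D y => ?; apply: is_derive_eq; ring.
Qed.

End Jets.

(** * Asymptotics *)

Section FlowEstimates.
Context {R : realType}.
Variables (beta k c : R) (phi : R -> R).
Hypothesis fd : flow_data beta k c phi.

Let flow_facts : [/\ 0 < beta, 0 < c, 0 < k, k < 1 & c <= k] /\
  [/\ 0 < phi 1, phi 1 < pi / 2, 0 < pi :> R & -1 <= k <= 1].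
Proof.
have /andP[T0 Tpi] := fd_1 fd; have k0 := flow_k_gt0 fd; have k1 := fd_k fd.
split; split; rewrite ?(fd_beta fd) ?(fd_c fd) ?(fd_ck fd) ?pi_gt0 //.
by apply/andP; split; lra.
Qed.

(** The sines of the two angles differ by at most [c], and between the angles the derivative [cos]
    is at least [cos (asin k) = sqrt (1 - k^2)]. *)
Lemma flow_end_asin : 0 <= asin k - phi 1 <= c / Num.sqrt (1 - k ^+ 2).
Proof.
have [[b0 c0 k0 k1 ck] [T0 Tpi pi0 kN11]] := flow_facts.
have /andP[s1 s2] := flow_end_sin fd.
have sk : sin (asin k) = k by rewrite asinK // in_itv.
have a1 := asin_lepi2 kN11; have a2 := asin_geNpi2 kN11.
have le : phi 1 <= asin k.
  rewrite leNgt; apply/negP => lt.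
  have : sin (asin k) < sin (phi 1) by rewrite ltr_sin // in_itv /=; apply/andP; split; lra.
  by rewrite sk ltNge s2.
have q0 : 0 < Num.sqrt (1 - k ^+ 2) by rewrite sqrtr_gt0 subr_gt0 expr_lt1 // ltW.
rewrite subr_ge0 le /= ler_pdivlMr // -cos_asin //.
have [x /andP[x1 x2] e] := is_derive_MVT le (fun z _ => is_derive_sin z).
have : cos (asin k) <= cos x.
  move: x2; rewrite le_eqVlt => /predU1P[-> //|x2]; apply: ltW.
  by rewrite ltr_cos // in_itv /=; apply/andP; split; lra.
move: e; rewrite sk; nra.
Qed.

Lemma flow_speed_range y : 0 <= y <= 1 ->
  sin (phi y) <= speed c (phi y) <= sin (phi y) + c /\ 0 <= sin (phi y) <= k.
Proof.
have [[b0 c0 k0 k1 ck] [T0 Tpi pi0 kN11]] := flow_facts.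
move=> y01; have /andP[p0 p1] := flow_range_pihalf fd y01.
have /andP[_ pT] := flow_range fd y01.
have s0 : 0 <= sin (phi y) by apply: sin_ge0_pi; apply/andP; split; lra.
have /andP[_ sTk] := flow_end_sin fd.
have sT : sin (phi y) <= sin (phi 1).
  move: pT; rewrite le_eqVlt => /predU1P[-> //|pT]; apply: ltW.
  by rewrite ltr_sin // in_itv /=; apply/andP; split; lra.
split; last by rewrite s0 (le_trans sT).
have := speed_ge_sin c (phi y); have := speed_le (phi y) (ltW c0).
by rewrite ger0_norm // => ? ->; rewrite addrC.
Qed.

Let inside (M y : R) : beta * M <= 1 -> 0 <= y <= M -> 0 <= 1 - beta * y <= 1.
Proof.
have [[b0 _ _ _ _] _] := flow_facts.
move=> bM /andP[y0 yM]; rewrite subr_ge0 gerBl mulr_ge0 ?(ltW b0) // andbT.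
by apply: le_trans bM; rewrite ler_pM2l.
Qed.

Lemma is_derive_reversed_flow y :
  is_derive y (1 : R) (fun y => phi (1 - beta * y)) (- speed c (phi (1 - beta * y))).
Proof.
have [[b0 c0 k0 k1 ck] [T0 Tpi pi0 kN11]] := flow_facts.
have := fd_ode fd (1 - beta * y) => ?; apply: is_derive_eq; rewrite /GRing.scale /=.
by field; rewrite gt_eqF.
Qed.

(** The two equations have right-hand sides [- speed c] and [- sin], which differ by at most [c] at
    equal arguments; the initial gap is [asin k - phi 1]. Their sum is the [d] of the Gronwall
    estimate. *)
Lemma flow_profile_close (M : R) (psi0 := fun y : R => 2 * atan (tan (asin k / 2) * expR (- y))) :
  beta * M <= 1 -> forall y, 0 <= y <= M ->
  `|phi (1 - beta * y) - psi0 y| <= 2 * (c + (asin k - phi 1)) * expR (2 * M).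
Proof.
have [[b0 c0 k0 k1 ck] [T0 Tpi pi0 kN11]] := flow_facts.
move=> bM; have /andP[d0 _] := flow_end_asin.
have [psid _] := separatrix_pendulum (tan (asin k / 2)).
apply: (gronwall (du := fun y => - speed c (phi (1 - beta * y)) + sin (psi0 y))).
- exact: ltr_pwDl.
- move=> y; have := is_derive_reversed_flow y => ?; have := psid y => ?.
  by apply: is_derive_eq; rewrite opprK.
- move=> y yM; have [/andP[s1 s2] _] := flow_speed_range (inside bM yM).
  have := sin_lipschitz (phi (1 - beta * y)) (psi0 y).
  by rewrite !ler_norml => /andP[? ?]; apply/andP; split; lra.
- rewrite mulr0 subr0 /psi0 oppr0 expR0 mulr1 tanK; last first.
    have := asin_lepi2 kN11; have := asin_geNpi2 kN11.
    by rewrite in_itv /= => ? ?; apply/andP; split; lra.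
  have -> : 2 * (asin k / 2) = asin k by lra.
  by rewrite distrC ger0_norm // lerDr ltW.
Qed.

(** The comparison is made for [sin phi / k] because it never exceeds 1. Its derivative is
    [- cos phi * speed / k], where [cos phi] is within [phi 1] of 1 and the speed within [c] of
    [sin phi], so the forcing is [c / k + phi 1]. *)
Lemma flow_profile_linear_close (M : R) : beta * M <= 1 -> forall y, 0 <= y <= M ->
  `|sin (phi (1 - beta * y)) / k - expR (- y)| <= 2 * (c / k + phi 1) * expR (2 * M).
Proof.
have [[b0 c0 k0 k1 ck] [T0 Tpi pi0 kN11]] := flow_facts.
move=> bM; have ck0 : 0 < c / k by rewrite divr_gt0.
apply: (gronwall (du := fun y => - (cos (phi (1 - beta * y)) * speed c (phi (1 - beta * y)) / k)
   + expR (- y))).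
- exact: addr_gt0.
- move=> y; have := is_derive_reversed_flow y => ?.
  by apply: is_derive_eq; rewrite /GRing.scale /=; ring.
- move=> y yM; have y01 := inside bM yM.
  have [/andP[s1 s2] /andP[s3 s4]] := flow_speed_range y01.
  have /andP[p0 p1] := flow_range fd y01.
  have := cos_lipschitz (phi (1 - beta * y)) 0; rewrite cos0 subr0 (ger0_norm p0).
  rewrite ler_norml => /andP[C1 _]; have C2 := cos_le1 (phi (1 - beta * y)).
  have C0 : 0 <= cos (phi (1 - beta * y)) by apply: cos_ge0_pihalf; apply/andP; split; lra.
  have -> : cos (phi (1 - beta * y)) * speed c (phi (1 - beta * y)) / k =
     cos (phi (1 - beta * y)) * (speed c (phi (1 - beta * y)) / k) by ring.
  set C := cos _ in C1 C2 C0 *.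
  set S := sin _ in s1 s2 s3 s4 *; set p := speed _ _ in s1 s2 *.
  have h1 : S / k <= p / k by rewrite ler_pM2r ?invr_gt0.
  have h2 : p / k <= S / k + c / k by rewrite -mulrDl ler_pM2r ?invr_gt0.
  have h3 : S / k <= 1 by rewrite ler_pdivrMr // mul1r.
  have h4 : 0 <= S / k by rewrite divr_ge0 // ltW.
  have h5 : C * (p / k) <= S / k + c / k by nra.
  have h6 : S / k - phi 1 <= C * (p / k) by nra.
  have := ler_norm (S / k - expR (- y)); have := ler_norm (- (S / k - expR (- y))).
  by rewrite normrN ler_norml => ? ?; apply/andP; split; lra.
- rewrite mulr0 subr0 oppr0 expR0; have /andP[s1 s2] := flow_end_sin fd.
  have h1 : sin (phi 1) / k <= 1 by rewrite ler_pdivrMr // mul1r.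
  have h2 : 1 - c / k <= sin (phi 1) / k.
    by rewrite ler_pdivlMr // mulrBl divfK ?gt_eqF // mul1r.
  by rewrite ler_norml; apply/andP; split; lra.
Qed.

(* Concavity of [sin] bounds the gap [phi - sin phi]; the exponential bound on [phi] turns
   it into an error relative to [k]. *)
Lemma flow_relative_sin y : 0 <= y <= 1 ->
  0 <= phi y / k - sin (phi y) / k <= 2 * phi 1 /\ phi y / k <= 2.
Proof.
have [[b0 c0 k0 k1 ck] [T0 Tpi pi0 kN11]] := flow_facts.
move=> y01; have /andP[p0 p1] := flow_range fd y01.
have p2 : phi y / k <= 2.
  rewrite ler_pdivrMr //; apply: le_trans (flow_le_exp fd y01) _.
  rewrite ger_pMr ?mulr_gt0 // expR_le1 pmulr_lle0 ?invr_gt0 // subr_le0.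
  by case/andP: y01.
split=> //; rewrite -mulrBl; apply/andP; split.
  by rewrite divr_ge0 ?(ltW k0) // subr_ge0 sin_le_id.
have p0pi : 0 <= phi y <= pi by apply/andP; split; lra.
have h := sin_sub_le p0pi.
have := cos_lipschitz (phi y) 0; rewrite cos0 subr0 (ger0_norm p0) ler_norml => /andP[C1 _].
have h1 : phi y - sin (phi y) <= phi y * phi 1 by nra.
apply: (@le_trans _ _ (phi y * phi 1 / k)); first by rewrite ler_pM2r ?invr_gt0.
by rewrite mulrAC ler_wpM2r // ltW.
Qed.

Variable G : R -> R.
Hypothesis G0 : G 0 = 0.
Hypothesis Gd : forall t, is_derive t (1 : R) G (speed c t).

Lemma primitive_end_close : 0 <= G (phi 1) - (1 - cos (phi 1)) <= c * phi 1.
Proof.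
have [[b0 c0 k0 k1 ck] [T0 Tpi pi0 kN11]] := flow_facts.
have D t : 0 <= t <= phi 1 ->
    is_derive t (1 : R) (fun t => G t - (1 - cos t)) (speed c t - sin t).
  by move=> _; have := Gd t => ?; apply: is_derive_eq; ring.
have [x /andP[x1 x2]] := is_derive_MVT (ltW T0) D.
rewrite G0 cos0 !subrr !subr0 => ->.
have s0 : 0 <= sin x by apply: sin_ge0_pi; apply/andP; split; lra.
have := speed_ge_sin c x; have := speed_le x (ltW c0); rewrite ger0_norm // => h1 h2.
by rewrite mulr_ge0 ?ler_pM2r ?T0 ?(ltW T0) // ?subr_ge0 // andTb; lra.
Qed.

Lemma flow_energy_close :
  `|(G (phi 1) - k * phi 1) - ((1 - Num.sqrt (1 - k ^+ 2)) - k * asin k)|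
    <= 2 * (c + (asin k - phi 1)).
Proof.
have [[b0 c0 k0 k1 ck] [T0 Tpi pi0 kN11]] := flow_facts.
have /andP[g1 g2] := primitive_end_close; have /andP[d0 _] := flow_end_asin.
rewrite -cos_asin //.
have := cos_lipschitz (phi 1) (asin k); rewrite distrC [leRHS]distrC (ger0_norm d0).
have cT : c * phi 1 <= c * 2.
  by rewrite ler_wpM2l ?(ltW c0) //; have := @pihalf_lt2 R; lra.
have kd : k * (asin k - phi 1) <= 1 * (asin k - phi 1) by rewrite ler_wpM2r // ltW.
have kd0 : 0 <= k * (asin k - phi 1) by rewrite mulr_ge0 // ltW.
rewrite !ler_norml => /andP[? ?]; apply/andP; split; lra.
Qed.

(** With [k = 2 kappa beta] the first two terms are the energy divided by [- kappa^2 beta / 2]. They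
    split into [- 2 eta - q + 2 t + c^2 / (beta k^2)], where [q] and [t] tend to 1 and the other two
    terms tend to 0. *)
Lemma flow_energy_linear_close : beta <= 1 ->
  `|- 2 * (G (phi 1) - k * phi 1) / k ^+ 2 + c ^+ 2 / (beta * k ^+ 2) - 1|
    <= (8 + 2 * expR 1) * (c / k) + 10 * k.
Proof.
have [[b0 c0 k0 k1 ck] [T0 Tpi pi0 kN11]] := flow_facts.
move=> b1; have /andP[g1 g2] := primitive_end_close.
have i01 : 0 <= (1 : R) <= 1 by rewrite ler01 lexx.
have [/andP[r1 r2] r3] := flow_relative_sin i01.
have /andP[s1 s2] := flow_end_sin fd.
have T2k := flow_end_le fd.
set e := c / k; set t := phi 1 / k in r1 r2 r3; set s := sin (phi 1) / k in r1 r2.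
have kn : k != 0 by rewrite gt_eqF.
have e0 : 0 < e by rewrite divr_gt0.
have e1 : e <= 1 by rewrite ler_pdivrMr // mul1r.
have h1 : s <= 1 by rewrite ler_pdivrMr // mul1r.
have h2 : 1 - e <= s by rewrite ler_pdivlMr // mulrBl divfK // mul1r.
set C := cos (phi 1) in g1 g2.
have C0 : 0 <= C by apply: cos_ge0_pihalf; apply/andP; split; lra.
have C1 : C <= 1 by exact: cos_le1.
have CT : 1 - C <= phi 1.
  have := cos_lipschitz (phi 1) 0; rewrite cos0 subr0 (gtr0_norm T0) -/C ler_norml.
  by case/andP=> *; lra.
have kk0 : 0 < k ^+ 2 by rewrite exprn_gt0.
set g := G (phi 1) in g1 g2 *.
pose eta := (g - (1 - C)) / k ^+ 2.
have eta0 : 0 <= eta by rewrite divr_ge0 // ltW.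
have eta1 : eta <= 2 * e.
  rewrite /eta ler_pdivrMr //; apply: le_trans g2 _.
  have -> : 2 * e * k ^+ 2 = c * (2 * k) by rewrite /e; field.
  by rewrite ler_wpM2l // ltW.
(* Multiplying by the conjugate [1 + C] replaces a second-order expansion of the cosine. *)
have CE : (1 - C) / k ^+ 2 = s ^+ 2 / (1 + C).
  have : C ^+ 2 = 1 - sin (phi 1) ^+ 2 by rewrite /C cos2sin2.
  rewrite /s => cc; have Cn : 1 + C != 0 by rewrite gt_eqF // ltr_pwDl.
  have : sin (phi 1) ^+ 2 = (1 - C) * (1 + C) by move: cc; rewrite !expr2; lra.
  by rewrite exprMn => ->; field; rewrite ?kn ?Cn.
pose q := 2 * (s ^+ 2 / (1 + C)).
have s0 : 0 <= s by lra.
have TC0 : 0 <= phi 1 * C by rewrite mulr_ge0 // ltW.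
have q1 : q <= 1 + phi 1.
  rewrite /q mulrA ler_pdivrMr ?ltr_pwDl //.
  by rewrite expr2; nra.
have q2 : 1 - 2 * e <= q.
  rewrite /q mulrA ler_pdivlMr ?ltr_pwDl // expr2.
  have s2e : 1 - 2 * e <= s * s by nra.
  by case: (leP (1 - 2 * e) 0) => ?; nra.
(* One factor [e = c / k] absorbs the division by [beta], because [expR (- beta^-1) <= beta]. *)
have cb : c ^+ 2 / (beta * k ^+ 2) <= 2 * expR 1 * e.
  have -> : c ^+ 2 / (beta * k ^+ 2) = e * (e / beta).
    by rewrite /e; field; rewrite kn gt_eqF.
  rewrite mulrC ler_wpM2r ?(ltW e0) // ler_pdivrMr //.
  have : e <= 2 * expR 1 * expR (- beta^-1).
    rewrite ler_pdivrMr //; apply: le_trans (flow_c_le fd b1) _.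
    by rewrite le_eqVlt; apply/orP; left; apply/eqP; ring.
  move=> /le_trans; apply; rewrite ler_wpM2l ?mulr_ge0 ?expR_ge0 //.
  rewrite expRN -[leRHS]invrK lef_pV2 ?posrE ?invr_gt0 ?expR_gt0 //.
  by have := expR_ge1Dx beta^-1; lra.
have cb0 : 0 <= c ^+ 2 / (beta * k ^+ 2).
  by rewrite divr_ge0 ?sqr_ge0 // mulr_ge0 ?(ltW b0) // ltW.
have E1 := expR_gt0 (1 : R).
have -> : - 2 * (g - k * phi 1) / k ^+ 2 = - 2 * eta - q + 2 * t.
  by rewrite /q -CE /eta /t; field.
rewrite ler_norml; apply/andP; split; nra.
Qed.

End FlowEstimates.

(** * One-sided limits at 0 and exponential decay against powers *)

Section Limits.
Context {R : realType}.

(** A single term of the exponential series at [a / b] bounds it from below. *)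
Lemma exp_decay (a : R) (n : nat) : 0 < a ->
  exists C : R, 0 <= C /\ forall b, 0 < b -> expR (- (a / b)) <= C * b ^+ n.+1.
Proof.
move=> a0; exists (n.+1`!%:R / a ^+ n.+1).
have f0 : 0 < (n.+1`!%:R : R) by rewrite ltr0n fact_gt0.
split=> [|b b0]; first by rewrite divr_ge0 ?exprn_ge0 ?(ltW a0) // ltW.
have ab0 : 0 < a / b by rewrite divr_gt0.
have h : (a / b) ^+ n.+1 / n.+1`!%:R <= expR (a / b).
  by have := expR_ge1Dxn n (ltW ab0); lra.
have p0 : 0 < (a / b) ^+ n.+1 / n.+1`!%:R by rewrite divr_gt0 // exprn_gt0.
rewrite expRN; apply: (@le_trans _ _ ((a / b) ^+ n.+1 / n.+1`!%:R)^-1).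
  by rewrite lef_pV2 ?posrE ?expR_gt0.
by rewrite le_eqVlt; apply/orP; left; apply/eqP; rewrite invf_div expr_div_n; field;
  rewrite !expf_neq0 ?gt_eqF.
Qed.

Lemma cvg_right_small (g : R -> R) : g b @[b --> 0^'+] --> 0 ->
  forall e, 0 < e -> exists d, 0 < d /\ forall b, 0 < b < d -> g b < e.
Proof.
move=> g0 e e0; have [d /= d0 hd] := cvgr_lt _ g0 _ e0.
exists d; split=> // b /andP[b0 bd]; apply: hd => //=.
by rewrite sub0r normrN gtr0_norm.
Qed.

Lemma cvg_right_squeeze (f g : R -> R) (l : R) : g b @[b --> 0^'+] --> 0 ->
  (forall b, 0 < b < 1 -> `|f b - l| <= g b) -> f b @[b --> 0^'+] --> l.
Proof.
move=> g0 fg; apply/cvgrPdist_lt => e e0.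
have [d [d0 hd]] := cvg_right_small g0 e0.
near=> b; rewrite distrC; apply: (@le_lt_trans _ _ (g b)).
  by apply: fg; apply/andP; split; near: b; [exact: nbhs_right_gt|exact: nbhs_right_lt].
by apply: hd; apply/andP; split; near: b; [exact: nbhs_right_gt|exact: nbhs_right_lt].
Unshelve. all: by end_near.
Qed.

Lemma cvg_right_linear (C : R) : C * b @[b --> 0^'+] --> 0.
Proof.
rewrite -[X in _ --> X](mulr0 C); apply: cvgMr; apply: cvg_at_right_filter; exact: cvg_id.
Qed.

End Limits.

(** * Derivative estimates uniform over all flows *)

Section Uniform.
Context {R : realType}.

Lemma flow_c_decay (n : nat) : exists C : R, 0 <= C /\
  forall beta k c phi, @flow_data R beta k c phi -> beta <= 1 -> c / k <= C * beta ^+ n.+1.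
Proof.
have [C [C0 CP]] := exp_decay n (@ltr01 R).
exists (2 * expR 1 * C); split=> [|beta k c phi fd b1].
  by rewrite !mulr_ge0 ?expR_ge0.
rewrite ler_pdivrMr ?(flow_k_gt0 fd) //; apply: le_trans (flow_c_le fd b1) _.
have := CP beta (fd_beta fd); rewrite mul1r => h.
have -> : 2 * expR 1 * C * beta ^+ n.+1 * k = 2 * expR 1 * k * (C * beta ^+ n.+1) by ring.
by rewrite ler_wpM2l // !mulr_ge0 ?expR_ge0 // ltW // (flow_k_gt0 fd).
Qed.

(** Comparison with the rest state. Each derivative costs a factor [1 / beta]; up to [x = a] the
    distance to rest is of order [expR (- (1 - a) / beta)], hence of order [beta^(n+1)], which pays
    for [n] derivatives and leaves one power. *)
Lemma flow_derive1n_compact (a : R) (n : nat) : 0 <= a < 1 -> exists C : R, 0 <= C /\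
  forall beta k c phi, flow_data beta k c phi -> beta <= 1 -> forall x, 0 <= x <= a ->
  `|derive1n n phi x| <= C * beta.
Proof.
move=> /andP[a0 a1].
have a10 : 0 < 1 - a by rewrite subr_gt0.
have [C [C0 CP]] := exp_decay n a10.
have [K [K1 KP]] := @pendulum_derive1n_close R n.
exists (K * ((2 * expR 1 + 2) * C)); split=> [|beta k c phi fd b1 x /andP[x0 xa]].
  by rewrite !mulr_ge0 ?addr_ge0 ?mulr_ge0 ?expR_ge0 //; lra.
have b0 := fd_beta fd; have c0 := fd_c fd; have k0 := flow_k_gt0 fd; have k1 := fd_k fd.
have x01 : 0 <= x <= 1 by rewrite x0 /=; lra.
have [/andP[s1 s2] /andP[s3 s4]] := flow_speed_range fd x01.
have /andP[p0 pT] := flow_range fd x01.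
have E0 := expR_ge0 (- ((1 - a) / beta)).
have small : c + phi x <= (2 * expR 1 + 2) * expR (- ((1 - a) / beta)).
  have h1 : c <= 2 * expR 1 * expR (- ((1 - a) / beta)).
    apply: le_trans (flow_c_le fd b1) _.
    have le1 : expR (- beta^-1) <= expR (- ((1 - a) / beta)).
      by rewrite ler_expR lerN2 ler_pdivrMr // mulVf ?gt_eqF //; lra.
    rewrite ler_pM ?expR_ge0 //; first by rewrite !mulr_ge0 ?expR_ge0 // ltW.
    by rewrite ger_pMr ?mulr_gt0 ?expR_gt0 // ltW.
  have h2 : phi x <= 2 * expR (- ((1 - a) / beta)).
    apply: le_trans (flow_le_exp fd x01) _.
    rewrite ler_pM ?expR_ge0 ?mulr_ge0 ?(ltW k0) //; first lra.
    by rewrite ler_expR -mulNr ler_pM2r ?invr_gt0 //; lra.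
  by rewrite mulrDl lerD.
pose z := fun _ : R => 0 : R.
have zero : pendulum beta^-1 1 z z z (fun=> 1).
  by split=> y; rewrite /z; apply: is_derive_eq; rewrite ?mul0r ?mulr0 ?oppr0 ?mulr0.
have := KP _ _ _ _ _ _ _ _ _ _ _ x (c + phi x) (flow_pendulum b0 c0 (fd_ode fd)) zero.
have sx := sin_le_id p0.
have C1 : `|cos (phi x) - 1| <= c + phi x.
  have := cos_lipschitz (phi x) 0; rewrite cos0 subr0 (ger0_norm p0) => h.
  by apply: le_trans h _; rewrite lerDr ltW.
have sp : `|speed c (phi x)| <= c + phi x by rewrite ger0_norm ?speed_ge0 //; lra.
have ss : `|sin (phi x)| <= c + phi x by rewrite ger0_norm //; lra.
have pp : `|phi x| <= c + phi x by rewrite ger0_norm //; lra.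
have ck := fd_ck fd.
have sp2 : `|speed c (phi x)| <= 2 by rewrite ger0_norm ?speed_ge0 //; lra.
have ss2 : `|sin (phi x)| <= 2 by rewrite ger0_norm //; lra.
have cc2 : `|cos (phi x)| <= 2 by have := cos_max (phi x); lra.
have one2 : `|1 : R| <= 2 by rewrite normr1; lra.
have d0 : 0 <= c + phi x by rewrite addr_ge0 // ltW.
rewrite /z !subr0 subrr normr0 => /(_ sp2 ss2 cc2 one2 (ler0n _ _) (ler0n _ _) one2 one2 pp sp ss C1 d0).
have -> : derive1n n (fun=> (0 : R)) x = 0 by case: n {KP CP} => // n; exact: derive1n_cst.
rewrite subr0 => h; apply: le_trans h _.
rewrite (ger0_norm (x := beta^-1)) ?invr_ge0 ?(ltW b0) // exprVn.
rewrite mulrC ler_pdivrMr ?exprn_gt0 //.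
have -> : K * ((2 * expR 1 + 2) * C) * beta * beta ^+ n =
  K * ((2 * expR 1 + 2) * (C * beta ^+ n.+1)) by rewrite exprS; ring.
rewrite ler_wpM2l //; first lra.
apply: le_trans small _; rewrite ler_wpM2l ?CP //.
Qed.

Lemma flow_profile_derive1n (M : R) (n : nat) : 0 <= M -> exists C : R, 0 <= C /\
  forall beta k c phi, flow_data beta k c phi -> beta * M <= 1 -> forall y, 0 <= y <= M ->
  `|derive1n n (fun y => phi (1 - beta * y)) y
    - derive1n n (fun y => 2 * atan (tan (asin k / 2) * expR (- y))) y|
    <= C * (c + (asin k - phi 1)).
Proof.
move=> M0; have [K [K1 KP]] := @pendulum_derive1n_close R n.
have EM : 1 <= expR (2 * M) by rewrite -expR0 ler_expR mulr_ge0.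
exists (K * (3 * expR (2 * M))); split=> [|beta k c phi fd bM y yM].
  by rewrite !mulr_ge0 ?expR_ge0 //; lra.
have b0 := fd_beta fd; have c0 := fd_c fd; have ck := fd_ck fd; have k1 := fd_k fd.
have /andP[d0 _] := flow_end_asin fd.
have close := flow_profile_close fd bM yM.
have y01 : 0 <= 1 - beta * y <= 1.
  case/andP: yM => y0 yM; rewrite subr_ge0 gerBl mulr_ge0 ?(ltW b0) // andbT.
  by apply: le_trans bM; rewrite ler_pM2l.
have [/andP[s1 s2] /andP[s3 s4]] := flow_speed_range fd y01.
have [_ P'] := separatrix_pendulum (tan (asin k / 2)).
have P := rescaled_flow_pendulum b0 c0 ltr01 (fd_ode fd).
set psi0 := fun y => _ in close P' *.
set p := phi (1 - beta * y) in close s1 s2 s3 s4.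
(* Two units come from the Gronwall bound. The third pays for passing from [speed c p] to [sin p] in
   the slope, an error of at most [c]. *)
set d := 3 * (c + (asin k - phi 1)) * expR (2 * M).
have cd : c + 2 * (c + (asin k - phi 1)) * expR (2 * M) <= d.
  have : c * 1 <= (c + (asin k - phi 1)) * expR (2 * M) by rewrite ler_pM ?ler01 ?lerDl // ltW.
  by rewrite /d; lra.
have sc := sin_lipschitz p (psi0 y); have cc := cos_lipschitz p (psi0 y).
have -> : (fun y => phi (1 - beta * y)) = (fun y => phi (1 - beta * y) / 1).
  by apply/funext => z; rewrite divr1.
have one2 : `|1 : R| <= 2 by rewrite normr1; lra.
have le2 (u : R) : `|u| <= 1 -> `|u| <= 2 by lra.
have := KP _ _ _ _ _ _ _ _ _ _ _ y d P P'.
rewrite !divr1 -/p normr1 expr1n mul1r.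
move=> h; apply: le_trans (h _ _ _ _ _ _ _ _ _ _ _ _ _) _ => //.
- by rewrite normrN ger0_norm ?speed_ge0 //; lra.
- exact/le2/sin_max.
- exact/le2/cos_max.
- lra.
- by rewrite normrN; exact/le2/sin_max.
- exact/le2/sin_max.
- exact/le2/cos_max.
- lra.
- by rewrite -/(psi0 y); lra.
- rewrite -/(psi0 y) -opprD normrN.
  have -> : speed c p - sin (psi0 y) = (speed c p - sin p) + (sin p - sin (psi0 y)) by ring.
  apply: le_trans (ler_normD _ _) _.
  have : `|speed c p - sin p| <= c by rewrite ger0_norm; lra.
  lra.
- by rewrite -/(psi0 y); lra.
- by rewrite -/(psi0 y); lra.
- by rewrite subrr normr0 /d !mulr_ge0 ?expR_ge0 // addr_ge0 // ltW.
- by rewrite /d le_eqVlt; apply/orP; left; apply/eqP; ring.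
Qed.

Lemma flow_linear_derive1n (M : R) (n : nat) : 0 <= M -> exists C : R, 0 <= C /\
  forall beta k c phi, flow_data beta k c phi -> beta * M <= 1 -> forall y, 0 <= y <= M ->
  `|derive1n n (fun y => phi (1 - beta * y) / k) y - derive1n n (fun y => expR (- y)) y|
    <= C * (c / k + k).
Proof.
move=> M0; have [K [K1 KP]] := @pendulum_derive1n_close R n.
have EM : 1 <= expR (2 * M) by rewrite -expR0 ler_expR mulr_ge0.
exists (K * (11 * expR (2 * M))); split=> [|beta k c phi fd bM y yM].
  by rewrite !mulr_ge0 ?expR_ge0 //; lra.
have b0 := fd_beta fd; have c0 := fd_c fd; have ck := fd_ck fd; have k1 := fd_k fd.
have k0 := flow_k_gt0 fd.
have close := flow_profile_linear_close fd bM yM.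
have y01 : 0 <= 1 - beta * y <= 1.
  case/andP: yM => y0 yM; rewrite subr_ge0 gerBl mulr_ge0 ?(ltW b0) // andbT.
  by apply: le_trans bM; rewrite ler_pM2l.
have [/andP[s1 s2] /andP[s3 s4]] := flow_speed_range fd y01.
have [/andP[r1 r2] _] := flow_relative_sin fd y01.
have /andP[p0 pT] := flow_range fd y01.
have T2k := flow_end_le fd.
have P := rescaled_flow_pendulum b0 c0 k0 (fd_ode fd).
set p := phi (1 - beta * y) in close s1 s2 s3 s4 r1 r2 p0 pT.
(* With [phi 1 <= 2 k] the term [3 (c / k + phi 1)] contributes [6 k], and [2 phi 1 + k] contributes
   [5 k]. *)
set d := (11 * expR (2 * M)) * (c / k + k).
have e0 : 0 < c / k by rewrite divr_gt0.
have e1 : c / k <= 1 by rewrite ler_pdivrMr // mul1r.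
have cd : 3 * (c / k + phi 1) * expR (2 * M) + 2 * phi 1 + k <= d.
  have h1 : 3 * (c / k + phi 1) * expR (2 * M) <= 3 * (c / k + 2 * k) * expR (2 * M).
    by rewrite ler_wpM2r ?expR_ge0 //; lra.
  have h2 : 5 * k * 1 <= 5 * k * expR (2 * M) by rewrite ler_wpM2l //; lra.
  have h3 : 0 <= 8 * (c / k) * expR (2 * M) by rewrite mulr_ge0 ?expR_ge0 //; lra.
  by rewrite /d; lra.
have cE : c / k * 1 <= (c / k + phi 1) * expR (2 * M).
  by rewrite ler_pM ?ler01 ?lerDl //; [exact: ltW|lra].
have cE0 : 0 <= (c / k + phi 1) * expR (2 * M) by rewrite mulr_ge0 ?expR_ge0 //; lra.
have C1 := cos_lipschitz p 0; rewrite cos0 subr0 (ger0_norm p0) in C1.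
have h1 : sin p / k <= speed c p / k by rewrite ler_pM2r ?invr_gt0.
have h2 : speed c p / k <= sin p / k + c / k by rewrite -mulrDl ler_pM2r ?invr_gt0.
have h3 : sin p / k <= 1 by rewrite ler_pdivrMr // mul1r.
have h4 : 0 <= sin p / k by rewrite divr_ge0 // ltW.
have Ey : 0 < expR (- y) <= 1.
  by rewrite expR_gt0 expR_le1 oppr_le0; case/andP: yM.
case/andP: Ey => Ey0 Ey1.
have one2 : `|1 : R| <= 2 by rewrite normr1; lra.
have := KP _ _ _ _ _ _ _ _ _ _ _ y d P (@exp_pendulum R).
rewrite -/p normr1 expr1n mul1r.
move=> h; apply: le_trans (h _ _ _ _ _ _ _ _ _ _ _ _ _) _.
- by rewrite mulNr normrN ger0_norm; lra.
- by rewrite ger0_norm; lra.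
- by have := cos_max p; lra.
- by rewrite gtr0_norm //; lra.
- by rewrite normrN gtr0_norm //; lra.
- by rewrite gtr0_norm //; lra.
- lra.
- by rewrite normr0; lra.
- have -> : p / k - expR (- y) = (p / k - sin p / k) + (sin p / k - expR (- y)) by ring.
  by apply: le_trans (ler_normD _ _) _; rewrite (ger0_norm r1); lra.
- have -> : - speed c p / k - - expR (- y) = - ((speed c p / k - sin p / k) + (sin p / k - expR (- y))) by ring.
  rewrite normrN; apply: le_trans (ler_normD _ _) _.
  have : `|speed c p / k - sin p / k| <= c / k by rewrite ger0_norm; lra.
  lra.
- lra.
- lra.
- by rewrite subr0 gtr0_norm //; lra.
- by rewrite /d !mulrA.
Qed.

End Uniform.

(** * Energy of the minimizer in the two regimes *)

Section EnergyAsymptotics.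
Context {R : realType}.

Lemma flow_is_minimizer (beta kappa c : R) (phi : R -> R) : 0 < kappa -> kappa * beta * pi <= 1 ->
  flow_data beta (2 * (kappa * beta)) c phi ->
  exists G : R -> R, [/\ G 0 = 0, forall t, is_derive t (1 : R) G (speed c t),
    is_minimizer beta kappa phi (fun x => speed c (phi x) / beta),
    (forall psi h, is_minimizer beta kappa psi h -> forall x, 0 <= x <= 1 -> psi x = phi x) &
    F beta kappa phi (fun x => speed c (phi x) / beta) =
      (G (phi 1) - 2 * (kappa * beta) * phi 1) / (4 * beta) - c ^+ 2 / (8 * beta ^+ 2)].
Proof.
move=> k0 kb fd.
have [G [G0 Gd]] := continuous_primitive (continuous_speed (fd_c fd)).
have i01 : 0 <= (1 : R) <= 1 by rewrite ler01 lexx.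
have [h1 h2 h3] := flow_minimizer (fd_beta fd) k0 (fd_c fd) kb (fd_0 fd)
  (flow_range_pihalf fd i01) (fd_ode fd) (flow_end_speed fd) Gd G0.
by exists G.
Qed.

Lemma flow_F_close (beta kappa c : R) (phi : R -> R) (kt := kappa * beta) :
  0 < kappa -> kt * pi <= 1 -> flow_data beta (2 * kt) c phi -> beta <= 1 ->
  `|F beta kappa phi (fun x => speed c (phi x) / beta)
    - ((1 - Num.sqrt (1 - 4 * kt ^+ 2)) / (4 * beta) - kt / (2 * beta) * asin (2 * kt))|
    <= (2 + (Num.sqrt (1 - 4 * kt ^+ 2))^-1) * c / beta ^+ 2.
Proof.
move=> k0 kb fd b1; have b0 := fd_beta fd; have c0 := fd_c fd.
have [G [G0 Gd _ _ ->]] := flow_is_minimizer k0 kb fd.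
have := flow_energy_close fd G0 Gd; have /andP[d0] := flow_end_asin fd.
have -> : (2 * kt) ^+ 2 = 4 * kt ^+ 2 by ring.
set q := Num.sqrt _; rewrite -/kt => dq.
set A := G (phi 1) - _; set B := 1 - q - _ => AB.
have -> : A / (4 * beta) - c ^+ 2 / (8 * beta ^+ 2) -
    ((1 - q) / (4 * beta) - kt / (2 * beta) * asin (2 * kt)) =
    ((A - B) * beta / 4 - c ^+ 2 / 8) / beta ^+ 2.
  by rewrite /B; field; rewrite gt_eqF.
rewrite normrM (ger0_norm (x := (beta ^+ 2)^-1)) ?invr_ge0 ?sqr_ge0 //.
rewrite ler_wpM2r ?invr_ge0 ?sqr_ge0 //.
apply: le_trans (ler_normB _ _) _.
have h1 : `|(A - B) * beta / 4| <= 2 * (c + c / q) / 4.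
  rewrite !normrM (gtr0_norm b0) (ger0_norm (x := 4^-1)) // ler_wpM2r //.
  rewrite -[leRHS]mulr1 ler_pM ?(ltW b0) //; lra.
have h2 : `|c ^+ 2 / 8| <= c / 8.
  rewrite ger0_norm ?divr_ge0 ?sqr_ge0 // ler_wpM2r // expr2 ger_pMl //.
  have := fd_ck fd; have := fd_k fd; lra.
have q0 : 0 <= c / q by rewrite divr_ge0 ?sqrtr_ge0 // ltW.
have -> : (2 + q^-1) * c = 2 * c + c / q by ring.
lra.
Qed.

Lemma flow_F_ratio_close (beta kappa c : R) (phi : R -> R) (k := 2 * (kappa * beta)) :
  0 < kappa -> kappa * beta * pi <= 1 -> flow_data beta k c phi -> beta <= 1 ->
  `|F beta kappa phi (fun x => speed c (phi x) / beta) / (- (kappa ^+ 2 * beta / 2)) - 1|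
    <= (8 + 2 * expR 1) * (c / k) + 10 * k.
Proof.
move=> k0 kb fd b1; have b0 := fd_beta fd.
have [G [G0 Gd _ _ ->]] := flow_is_minimizer k0 kb fd.
apply: le_trans (flow_energy_linear_close fd G0 Gd b1).
rewrite le_eqVlt; apply/orP; left; apply/eqP; congr `|_ - 1|.
by rewrite /k; field; rewrite !gt_eqF.
Qed.

End EnergyAsymptotics.

(** * Choice of the family of flows and passage to the limit *)

Theorem theorem1 (R : realType) (kappa : R -> R) :
  (forall beta : R, 0 < beta -> 0 < kappa beta) ->
  (forall beta : R, 0 < beta -> kappa beta < 1 / (pi * beta)) ->
  exists beta0 : R, 0 < beta0 /\
  exists phi dphi : R -> R -> R,
    (* existence and uniqueness of the minimizer *)
    (forall beta, 0 < beta < beta0 ->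
       is_minimizer beta (kappa beta) (phi beta) (dphi beta) /\
       (forall psi h, is_minimizer beta (kappa beta) psi h ->
          forall x, 0 <= x <= 1 -> psi x = phi beta x) /\
       (* phi_beta is smooth up to the boundary of [0,1] *)
       smooth_on (-1) 2 (phi beta) /\
       (forall x, 0 < x < 1 -> 0 < phi beta x < pi / 2) /\
       (forall x, 0 <= x < 1 ->
          phi beta x < 2 * atan (tan (phi beta 1 / 2) * expR ((x - 1) / beta)))) /\
    (* phi_beta -> 0 in C^infty(K) for every compact K in [0,1) *)
    (forall a : R, 0 <= a < 1 -> forall (k : nat) (e : R), 0 < e ->
       exists d : R, 0 < d /\ forall beta, 0 < beta < d -> beta < beta0 ->
         forall x, 0 <= x <= a -> `|derive1n k (phi beta) x| < e) /\
    (* case (i) *)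
    (forall kt : R, (forall beta, 0 < beta -> kappa beta * beta = kt) ->
       ((fun beta => phi beta 1) @ (0:R)^'+ --> asin (2 * kt)) /\
       (forall n : nat, (0 < n)%N ->
          (fun beta => (F beta (kappa beta) (phi beta) (dphi beta)
            - ((1 - Num.sqrt (1 - 4 * kt ^+ 2)) / (4 * beta)
               - kt / (2 * beta) * asin (2 * kt))) / beta ^+ n)
            @ (0:R)^'+ --> 0) /\
       (forall M : R, 0 < M -> forall (k : nat) (e : R), 0 < e ->
          exists d : R, 0 < d /\ forall beta, 0 < beta < d -> beta < beta0 ->
            forall x, 0 <= x <= M ->
              `|derive1n k (fun y => phi beta (1 - beta * y)) x
                - derive1n k (fun y => 2 * atan (tan (asin (2 * kt) / 2) * expR (- y))) x|
              < e)) /\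
    (* case (ii) *)
    (((fun beta => kappa beta * beta) @ (0:R)^'+ --> 0) ->
       ((fun beta => phi beta 1 / (2 * kappa beta * beta)) @ (0:R)^'+ --> (1:R)) /\
       ((fun beta => F beta (kappa beta) (phi beta) (dphi beta) / (- (kappa beta ^+ 2 * beta / 2)))
          @ (0:R)^'+ --> (1:R)) /\
       (forall M : R, 0 < M -> forall (k : nat) (e : R), 0 < e ->
          exists d : R, 0 < d /\ forall beta, 0 < beta < d -> beta < beta0 ->
            forall x, 0 <= x <= M ->
              `|derive1n k (fun y => phi beta (1 - beta * y) / (2 * kappa beta * beta)) x
                - derive1n k (fun y => expR (- y)) x| < e)).
Proof.
move=> kpos klt.
pose k b := 2 * (kappa b * b).
have pi0 := @pi_gt0 R; have pi2 := @pi_ge2 R.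
have kp b : 0 < b -> kappa b * b * pi < 1.
  by move=> b0; have := klt b b0; rewrite ltr_pdivlMr ?mulr_gt0 // [pi * b]mulrC mulrA.
have k0 b : 0 < b -> 0 < k b by move=> b0; rewrite !mulr_gt0 ?kpos.
have k1 b : 0 < b -> k b < 1.
  move=> b0; have := kp b b0; rewrite /k; have : 0 < kappa b * b by rewrite mulr_gt0 ?kpos.
  by nra.
have flow_ex b : exists cp : R * (R -> R), 0 < b -> flow_data b (k b) cp.1 cp.2.
  (* The pair for nonpositive [b] is a dummy value that makes the choice function total. *)
  case: (leP b 0) => [_|b0]; first by exists (0, id).
  have kb : 0 < k b < 1 by rewrite k0 ?k1.
  have [c [phi [/andP[c0 ck] phi0 phi1 phis phid]]] := flow_exists b0 kb.
  by exists (c, phi) => _; split; rewrite ?k1.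
have [cp cpP] := choice flow_ex.
pose c b := (cp b).1; pose phi b := (cp b).2.
have fd b : 0 < b -> flow_data b (k b) (c b) (phi b) by exact: cpP.
have kb1 b : 0 < b -> kappa b * b * pi <= 1 by move=> b0; exact/ltW/kp.
pose dphi b x := speed (c b) (phi b x) / b.
have kE b : 2 * kappa b * b = k b by rewrite /k mulrA.
(* The flow exists for every positive parameter; the bound 1 is the range in which the decay
   estimates are stated. *)
exists 1; split=> //; exists phi, dphi; split; last (split; last split).
- move=> b /andP[b0 b1]; have fdb := fd b b0.
  have [G [_ _ hmin huniq _]] := flow_is_minimizer (kpos b b0) (kb1 b b0) fdb.
  split; [exact: hmin|split; [exact: huniq|split; [|split]]].
  + by move=> n x _; exact: (pendulum_derivable (flow_pendulum b0 (fd_c fdb) (fd_ode fdb))).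
  + by move=> x; exact: (flow_range_strict fdb).
  + by move=> x; exact: (flow_lt_separatrix fdb).
- move=> a a01 n e e0; have [C [C0 CP]] := flow_derive1n_compact n a01.
  have [d [d0 hd]] := cvg_right_small (cvg_right_linear C) e0.
  exists d; split=> // b /andP[b0 bd] b1 x xa.
  apply: le_lt_trans (CP _ _ _ _ (fd b b0) (ltW b1) x xa) _.
  by apply: hd; rewrite b0.
- move=> kt ktE.
  have kc b : 0 < b -> k b = 2 * kt by move=> b0; rewrite /k ktE.
  have i01 : 0 < (1 : R) by [].
  have kt1 : 2 * kt < 1 by rewrite -(kc 1 i01) k1.
  have kt0 : 0 < 2 * kt by rewrite -(kc 1 i01) k0.
  set q := Num.sqrt (1 - (2 * kt) ^+ 2).
  have q0 : 0 < q by rewrite sqrtr_gt0 subr_gt0 expr_lt1 // ltW.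
  have iq0 : 0 < q^-1 by rewrite invr_gt0.
  have fdk b : 0 < b -> flow_data b (2 * kt) (c b) (phi b).
    by move=> b0; rewrite -(kc b b0); exact: fd.
  have decay n : exists C : R, 0 <= C /\ forall b, 0 < b < 1 -> c b <= C * b ^+ n.+1.
    have [C [C0 CP]] := @flow_c_decay R n; exists C; split=> // b /andP[b0 b1].
    apply: le_trans (CP _ _ _ _ (fdk b b0) (ltW b1)).
    by rewrite ler_pdivlMr // ger_pMr ?(fd_c (fdk b b0)) // ltW.
  have [C [C0 CP]] := decay 0%N.
  have gap b : 0 < b < 1 -> 0 <= asin (2 * kt) - phi b 1 <= C / q * b.
    move=> b01; have /andP[b0 b1] := b01.
    have /andP[-> h] := flow_end_asin (fdk b b0); apply: le_trans h _.
    by rewrite mulrAC ler_wpM2r ?(ltW iq0) // -[b in leRHS]expr1 CP.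
  split; last split.
  + apply: cvg_right_squeeze (cvg_right_linear (C / q)) _ => b b01.
    by have /andP[g0 g1] := gap b b01; rewrite distrC ger0_norm.
  (* This gives [c <= D b^(n+3)]: [n] powers for the division by [b^n], two for the [b^2] in the
     energy estimate, and one left to tend to 0. *)
  + move=> n n0; have [D [D0 DP]] := decay n.+2.
    apply: cvg_right_squeeze (cvg_right_linear ((2 + q^-1) * D)) _ => b b01.
    have /andP[b0 b1] := b01; rewrite subr0.
    have kb : kappa b * b * pi <= 1 by exact: kb1.
    have := flow_F_close (kpos b b0) kb (fd b b0) (ltW b1).
    rewrite (ktE b b0) => h.
    have bn0 : 0 < b ^+ n by rewrite exprn_gt0.
    rewrite normrM (gtr0_norm (x := (b ^+ n)^-1)) ?invr_gt0 //.
    rewrite ler_pdivrMr //; apply: le_trans h _.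
    have -> : 1 - 4 * kt ^+ 2 = 1 - (2 * kt) ^+ 2 by ring.
    rewrite -/q ler_pdivrMr ?exprn_gt0 //.
    have -> : (2 + q^-1) * D * b * b ^+ n * b ^+ 2 = (2 + q^-1) * (D * b ^+ n.+3).
      by rewrite -[n.+3]addn3 exprD; ring.
    by rewrite ler_wpM2l ?DP // addr_ge0 // ltW.
  + move=> M M0 n e e0.
    have [D [D0 DP]] := flow_profile_derive1n n (ltW M0).
    have [d [d0 hd]] := cvg_right_small (cvg_right_linear (D * (C + C / q))) e0.
    (* The bound [M^-1] keeps [1 - b * y] inside [[0, 1]] for all [y] up to [M]. *)
    exists (Num.min d M^-1); split; first by rewrite lt_min d0 invr_gt0.
    move=> b /andP[b0]; rewrite lt_min => /andP[bd bM] b1 x xM.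
    have bM1 : b * M <= 1 by rewrite -ler_pdivlMr // div1r ltW.
    apply: le_lt_trans (DP _ _ _ _ (fdk b b0) bM1 x xM) _.
    have b01 : 0 < b < 1 by rewrite b0.
    apply: (@le_lt_trans _ _ (D * (C + C / q) * b)); last by apply: hd; rewrite b0.
    have -> : D * (C + C / q) * b = D * (C * b + C / q * b) by ring.
    rewrite ler_wpM2l // lerD //.
      by rewrite -[b in leRHS]expr1 CP.
    by have /andP[] := gap b b01.
- move=> kcvg.
  have k2cvg : k b @[b --> 0^'+] --> 0.
    by rewrite -[X in _ --> X](mulr0 2); apply: cvgMr.
  have [C [C0 CP]] := @flow_c_decay R 0%N.
  have ck b : 0 < b < 1 -> c b / k b <= C * b.
    by move=> /andP[b0 b1]; have := CP _ _ _ _ (fd b b0) (ltW b1); rewrite expr1.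
  have bound (A B : R) : A * (C * b) + B * k b @[b --> 0^'+] --> 0.
    rewrite -[X in _ --> X](addr0 0); apply: cvgD.
      by under eq_fun do rewrite mulrA; exact: cvg_right_linear.
    by rewrite -[X in _ --> X](mulr0 B); apply: cvgMr.
  have i01 : 0 <= (1 : R) <= 1 by rewrite ler01 lexx.
  split; last split.
  (* [sin (phi 1) / k] is within [c / k] of 1, and passing from the sine to the angle costs at most
     [2 phi 1 <= 4 k]. *)
  + apply: cvg_right_squeeze (bound 1 4) _ => b b01.
    have /andP[b0 b1] := b01; have fdb := fd b b0; rewrite kE.
    have [/andP[r1 r2] _] := flow_relative_sin fdb i01.
    have /andP[s1 s2] := flow_end_sin fdb; have T2k := flow_end_le fdb.
    have h1 : sin (phi b 1) / k b <= 1 by rewrite ler_pdivrMr ?k0 // mul1r.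
    have h2 : 1 - c b / k b <= sin (phi b 1) / k b.
      by rewrite ler_pdivlMr ?k0 // mulrBl divfK ?gt_eqF ?k0 // mul1r.
    have := ck b b01; rewrite ler_norml => h3; apply/andP; split; have := k0 b b0; lra.
  + apply: cvg_right_squeeze (bound (8 + 2 * expR 1) 10) _ => b b01.
    have /andP[b0 b1] := b01.
    apply: le_trans (flow_F_ratio_close (kpos b b0) (kb1 b b0) (fd b b0) (ltW b1)) _.
    rewrite lerD2r ler_wpM2l ?ck // addr_ge0 // mulr_ge0 // expR_ge0.
  + move=> M M0 n e e0.
    have [D [D0 DP]] := flow_linear_derive1n n (ltW M0).
    have [d [d0 hd]] := cvg_right_small (bound D D) e0.
    exists (Num.min d M^-1); split; first by rewrite lt_min d0 invr_gt0.
    move=> b /andP[b0]; rewrite lt_min => /andP[bd bM] b1 x xM.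
    have bM1 : b * M <= 1 by rewrite -ler_pdivlMr // div1r ltW.
    rewrite kE; apply: le_lt_trans (DP _ _ _ _ (fd b b0) bM1 x xM) _.
    apply: le_lt_trans (hd b _); last by rewrite b0.
    by rewrite mulrDr lerD2r ler_wpM2l // ck // b0.
Qed.
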